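(* Let $a\in\mathbb{R}$ and suppose that $\{\lambda_i,\varphi_i(a)\}_{i=1}^N$ is the interior spectral data at $a$ of some pair $(\omega,v)$, and that $\alpha=\beta=0$. If there are exactly $k\ge1$ indices $i$ with $\varphi_i(a)=0$, then infinitely many pairs $(\omega,v)$ yield the given interior spectral data $\{\lambda_i,\varphi_i(a)\}_{i=1}^N$ at $a$, and $\mathcal{F}$ is a connected manifold of dimension $k$.
   Context: A pair $(\omega,v)$ means: for some $n\in\mathbb{N}$, $n\ge 1$, and real points $x_1<\dots<x_n$, $\omega=\sum_{i=1}^n\omega_i\delta_{x_i}$ and $v=\sum_{i=1}^n v_i\delta_{x_i}$ with $\omega_i\in\mathbb{R}$, $v_i\ge 0$ and $|\omega_i|+v_i>0$ ($\delta_x$ is the Dirac measure at $x$). The number $n$, the points and the weights may differ from pair to pair. For $z\in\mathbb{C}$ consider $-f''+\frac14 f=z\omega f+z^2vf$ on $\mathbb{R}$, meaning: $f$ is continuous, $-f''+\frac14 f=0$ on $\mathbb{R}\setminus\{x_1,\dots,x_n\}$, and $f'(x_i-)=f'(x_i+)+z\omega_if(x_i)+z^2v_if(x_i)$ for every $i$. An eigenvalue is a $z$ for which there is a nontrivial bounded solution. The eigenvalues form a finite set of nonzero real numbers $\lambda_1<\dots<\lambda_N$. For $z\in\mathbb{C}$, $\phi_\pm(z,\cdot)$ are the solutions with $\phi_\pm(z,x)=e^{\mp x/2}$ for all $x$ near $\pm\infty$. For an eigenvalue $\lambda$ put $\gamma_\lambda^2:=\int_{\mathbb{R}}|\phi_+(\lambda,x)|^2d\omega(x)+2\lambda\int_{\mathbb{R}}|\phi_+(\lambda,x)|^2dv(x)$;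 one has $\lambda\gamma_\lambda^2>0$. The normalized eigenfunctions are $\varphi_i(x)=\phi_+(\lambda_i,x)/\sqrt{\lambda_i\gamma_{\lambda_i}^2}$. For $a\in\mathbb{R}$, the family $\{\lambda_i,\varphi_i(a)\}_{i=1}^N$ is called the interior spectral data of $(\omega,v)$ at $a$. Put $\alpha:=1-\sum_{i=1}^N|\varphi_i(a)|^2$ and $\beta:=-\sum_{i=1}^N\lambda_i|\varphi_i(a)|^2$. The spectral data of a pair is the vector $(\lambda_1,\dots,\lambda_N,\lambda_1\gamma_{\lambda_1}^2,\dots,\lambda_N\gamma_{\lambda_N}^2)\in\mathbb{R}^{2N}$. For given interior spectral data at $a$, $\mathcal{F}\subset\mathbb{R}^{2N}$ denotes the set of spectral data of all pairs whose interior spectral data at $a$ is the given one. *)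

(* Defs.v *)
From HB Require Import structures.
From mathcomp Require Import all_boot all_order all_algebra.
From mathcomp Require Import complex.
From mathcomp Require Import all_classical all_reals all_analysis.

Set Implicit Arguments.
Unset Strict Implicit.
Unset Printing Implicit Defensive.

Import Order.TTheory GRing.Theory Num.Theory.
Import numFieldNormedType.Exports.
Import Normc.

Local Open Scope classical_set_scope.
Local Open Scope ring_scope.
Local Open Scope complex_scope.

Definition loc (R : realType) (A : R * R * R) : R := A.1.1.
Definition womega (R : realType) (A : R * R * R) : R := A.1.2.
Definition wv (R : realType) (A : R * R * R) : R := A.2.

(* A pair (omega, v) is the list of its atoms [(x, w, v)], contributing
   [w \delta_x] to omega and [v \delta_x] to v.  Since the points strictly
   increase and no atom is void, distinct lists satisfying this predicate are
   distinct pairs of measures. *)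
Definition is_pair (R : realType) (mu : seq (R * R * R)) : Prop :=
  [/\ (0 < size mu)%N,
      sorted <%R [seq loc A | A <- mu],
      {in mu, forall A, 0 <= wv A} &
      {in mu, forall A, 0 < `|womega A| + wv A}].

Definition int_omega (R : realType) (mu : seq (R * R * R)) (h : R -> R) : R :=
  \sum_(A <- mu) womega A * h (loc A).

Definition int_v (R : realType) (mu : seq (R * R * R)) (h : R -> R) : R :=
  \sum_(A <- mu) wv A * h (loc A).

(* [R[i]] comes without a normed-module structure over [R], so limits and
   derivatives of functions [R -> R[i]] are taken componentwise. *)
Definition rpart (R : realType) (f : R -> R[i]) : R -> R :=
  fun x => complex.Re (f x).
Definition ipart (R : realType) (f : R -> R[i]) : R -> R :=
  fun x => complex.Im (f x).

Definition ccontinuous (R : realType) (f : R -> R[i]) : Prop :=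
  continuous (rpart f) /\ continuous (ipart f).

Definition ccvg (R : realType) (f : R -> R[i]) (F : set_system R) (l : R[i])
    : Prop :=
  rpart f @ F --> complex.Re l /\ ipart f @ F --> complex.Im l.

Definition cderivable (R : realType) (f : R -> R[i]) (x : R) : Prop :=
  derivable (rpart f) x 1 /\ derivable (ipart f) x 1.

Definition cderive (R : realType) (f : R -> R[i]) : R -> R[i] :=
  fun x => derive1 (rpart f) x +i* derive1 (ipart f) x.

Definition solution (R : realType) (mu : seq (R * R * R)) (z : R[i])
    (f : R -> R[i]) : Prop :=
  [/\ ccontinuous f,
      (forall x, x \notin [seq loc A | A <- mu] ->
         [/\ cderivable f x, cderivable (cderive f) x &
             - cderive (cderive f) x + 4^-1 * f x = 0]) &
      {in mu, forall A, exists dl dr : R[i],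
         [/\ ccvg (cderive f) (at_left (loc A)) dl,
             ccvg (cderive f) (at_right (loc A)) dr &
             dl = dr + z * (womega A)%:C * f (loc A)
                     + z ^+ 2 * (wv A)%:C * f (loc A)]}].

Definition eigenvalue (R : realType) (mu : seq (R * R * R)) (z : R[i]) : Prop :=
  exists f : R -> R[i],
    [/\ solution mu z f,
        (exists x, f x != 0) &
        (exists M : R, forall x, normc (f x) <= M)].

Definition is_phi_plus (R : realType) (mu : seq (R * R * R)) (z : R[i])
    (f : R -> R[i]) : Prop :=
  solution mu z f /\ \forall x \near +oo, f x = (expR (- x / 2))%:C.

(* There is exactly one such solution, so the default value is irrelevant. *)
Definition phi_plus (R : realType) (mu : seq (R * R * R)) (z : R[i])
    : R -> R[i] :=
  xget (fun=> 0) [set f | is_phi_plus mu z f].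

Definition gamma2 (R : realType) (mu : seq (R * R * R)) (lam : R) : R :=
  int_omega mu (fun x => normc (phi_plus mu lam%:C x) ^+ 2)
  + 2 * lam * int_v mu (fun x => normc (phi_plus mu lam%:C x) ^+ 2).

Definition eigenvalues (R : realType) (mu : seq (R * R * R)) (N : nat)
    (lam : 'I_N -> R) : Prop :=
  (forall i j : 'I_N, (i < j)%N -> lam i < lam j) /\
  (forall z : R[i], eigenvalue mu z <-> exists i, z = (lam i)%:C).

Definition varphi (R : realType) (mu : seq (R * R * R)) (lam : R)
    : R -> R[i] :=
  fun x => phi_plus mu lam%:C x / (Num.sqrt (lam * gamma2 mu lam))%:C.

Definition interior_spectral_data (R : realType) (mu : seq (R * R * R)) (a : R)
    (N : nat) (lam : 'I_N -> R) (p : 'I_N -> R[i]) : Prop :=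
  eigenvalues mu lam /\ forall i, p i = varphi mu (lam i) a.

Definition alpha (R : realType) (N : nat) (p : 'I_N -> R[i]) : R :=
  1 - \sum_(i < N) normc (p i) ^+ 2.

Definition beta (R : realType) (N : nat) (lam : 'I_N -> R) (p : 'I_N -> R[i])
    : R :=
  - \sum_(i < N) lam i * normc (p i) ^+ 2.

Definition spectral_data (R : realType) (mu : seq (R * R * R)) (N : nat)
    (s : 'rV[R]_(N + N)) : Prop :=
  exists lam : 'I_N -> R, eigenvalues mu lam /\
    s = row_mx (\row_i lam i) (\row_i (lam i * gamma2 mu (lam i))).

Definition pairs_with (R : realType) (a : R) (N : nat) (lam : 'I_N -> R)
    (p : 'I_N -> R[i]) : set (seq (R * R * R)) :=
  [set mu | is_pair mu /\ interior_spectral_data mu a lam p].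

Definition spectral_set (R : realType) (a : R) (N : nat) (lam : 'I_N -> R)
    (p : 'I_N -> R[i]) : set 'rV[R]_(N + N) :=
  [set s | exists2 mu, pairs_with a lam p mu & spectral_data mu s].

Definition homeomorphic (T U : topologicalType) (A : set T) (B : set U)
    : Prop :=
  exists (f : T -> U) (g : U -> T),
    [/\ (forall x, A x -> B (f x) /\ g (f x) = x),
        (forall y, B y -> A (g y) /\ f (g y) = y),
        {within A, continuous f} &
        {within B, continuous g}].

(* [A], with the subspace topology, is locally homeomorphic to open subsets of
   [R^k]; as a subset of [R^m] it is Hausdorff and second countable. *)
Definition manifold (R : realType) (m k : nat) (A : set 'rV[R]_m) : Prop :=
  forall s, A s ->
    exists (U : set 'rV[R]_m) (V : set 'rV[R]_k),
      [/\ open U, U s, open V & homeomorphic (A `&` U) V].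

(* Main.v *)
Require Import Defs.
From HB Require Import structures.
From mathcomp Require Import all_boot all_order all_algebra.
From mathcomp Require Import complex.
From mathcomp Require Import all_classical all_reals all_analysis.
From mathcomp Require Import ring lra.

Set Implicit Arguments.
Unset Strict Implicit.
Unset Printing Implicit Defensive.

Import Order.TTheory GRing.Theory Num.Theory.
Import numFieldNormedType.Exports.
Import Normc.

Local Open Scope ring_scope.

(** Off the atoms a solution is A e^(x/2) + B e^(-x/2), and crossing an atom acts on (A, B)
    by a matrix of determinant 1 that is polynomial in z.  All spectral quantities of a pair
    are therefore read off from two polynomials, the coefficients (A, B) near -oo of the
    solution which is e^(-x/2) near +oo: the eigenvalues are the zeros of B, and
    lambda gamma_lambda^2 = - lambda A(lambda) B'(lambda) ([eigenvalueP],
    [gamma2_coupling]).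

    Cut the line at a.  Up to nonvanishing factors, phi_+(z, a) and phi_-(z, a) are
    polynomials Q_+ and Q_- in z which depend only on the atoms to the right, respectively
    to the left, of a.  At the eigenvalues,
    Q_+ Q_- = - lambda_i |varphi_i(a)|^2 B'(lambda_i), by the residues of the Green's
    function at a ([factors_residue]), so the interior data determine Q_+ Q_-.  The
    conditions alpha = beta = 0 say that this product has degree at most N - 2.  The sign
    of varphi_i(a) is that of Q_+(lambda_i), and with two degrees missing these signs
    determine Q_+ itself ([factor_unique]).  Hence lambda_i gamma_i^2, which equals
    e^(-a) Q_+(lambda_i)^2 / |varphi_i(a)|^2, is forced whenever varphi_i(a) is not 0.

    If varphi_i(a) = 0, then lambda_i is a common zero of Q_+ and Q_-, hence a common pole of
    the Weyl functions P_+/Q_+ and P_-/Q_- of the two half-lines.  Moving a part of the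
    residue from one function to the other changes neither Q_+, nor Q_-, nor B, and it gives
    lambda_i gamma_i^2 any prescribed positive value without touching the other ones
    ([redistribute]).  The new Weyl functions come again from finitely many atoms by an
    inverse theorem ([half_line_inverse]).  Its positivity input is that the kernel
    (P(y) Q(x) - P(x) Q(y)) / (x - y) is a sum of products b(x) b(y); peeling off one
    atom and one free interval, as well as lowering a residue, are Schur complements of
    this kernel.

    So the spectral set is a product of k open half-lines ([spectral_setP]), embedded as a
    coordinate orthant. *)

(** * Kernels of pairs of polynomials *)

(** Unlike [hornerE], these rules leave the association of products unchanged. *)
Definition horner_arith := (@hornerD, @hornerN, @hornerM, @hornerZ, @hornerX, @hornerC).

Definition gram (R : rcfType) (bs : seq {poly R}) (x y : R) : R :=
  \sum_(b <- bs) b.[x] * b.[y].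

(** The kernel is the Bezoutian of P and Q. It is positive semidefinite exactly when it is
    a sum of products b(x) b(y), and this form avoids matrices and roots altogether. *)
Definition psd_kernel (R : rcfType) (P Q : {poly R}) : Prop :=
  exists bs : seq {poly R}, forall x y : R,
    P.[y] * Q.[x] - P.[x] * Q.[y] = (x - y) * gram bs x y.

(** Up to normalisation, these are the pairs for which P / Q is the Weyl function of a
    half-line with finitely many atoms; such functions have real simple poles with
    positive residues. *)
Definition stieltjes (R : rcfType) (P Q : {poly R}) : Prop :=
  [/\ (size P < size Q)%N, coprimep P Q, Q.[0] = 1 & psd_kernel P Q].

Lemma poly_ext (R : numDomainType) (p q : {poly R}) :
  (forall x, p.[x] = q.[x]) -> p = q.
Proof.
move=> pq; apply/eqP; rewrite -subr_eq0; apply/eqP.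
apply: (@roots_geq_poly_eq0 _ _ [seq i%:R | i <- iota 0 (size (p - q)).+1]).
- by apply/allP => x _; rewrite rootE !horner_arith pq subrr.
- by rewrite map_inj_uniq ?iota_uniq // => i j /eqP; rewrite eqr_nat => /eqP.
- by rewrite size_map size_iota.
Qed.

Lemma size_XsubC_mul (R : idomainType) (q : {poly R}) (k : R) :
  q != 0 -> size (('X - k%:P) * q) = (size q).+1.
Proof. by move=> q0; rewrite size_monicM ?monicXsubC // size_XsubC. Qed.

(** The Schur complement of a Gram kernel with respect to the linear functional c is again
    a Gram kernel: by Lagrange's identity, it is the sum over all pairs (b, b') of the
    products of c(b') b - c(b) b', suitably normalised. *)
Lemma schur_gram (R : rcfType) (bs : seq {poly R}) (c : {poly R} -> R) :
  0 < \sum_(b <- bs) c b ^+ 2 ->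
  exists bs', forall x y, gram bs' x y = gram bs x y -
    (\sum_(b <- bs) c b ^+ 2)^-1 * ((\sum_(b <- bs) c b *: b).[x]
                                   * (\sum_(b <- bs) c b *: b).[y]).
Proof.
set d := \sum_(b <- bs) _ => d0.
pose k := Num.sqrt (2 * d)^-1.
have k2 : k * k = (2 * d)^-1 by rewrite -expr2 sqr_sqrtr // invr_ge0 mulr_ge0 // ltW.
exists [seq k *: (c b' *: b - c b *: b') | b <- bs, b' <- bs] => x y.
have hs z : (\sum_(b <- bs) c b *: b).[z] = \sum_(b <- bs) c b * b.[z].
  by rewrite horner_sum; apply: eq_bigr => b _; rewrite hornerZ.
rewrite !hs /gram big_allpairs_dep /=.
pose S := \sum_(b <- bs) b.[x] * b.[y].
pose u z := \sum_(b <- bs) c b * b.[z].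
transitivity (\sum_(b <- bs) (2 * d)^-1 * (d * (b.[x] * b.[y]) - c b * b.[x] * u y
   - c b * b.[y] * u x + c b ^+ 2 * S)).
  apply: eq_bigr => b _.
  have -> : d * (b.[x] * b.[y]) - c b * b.[x] * u y - c b * b.[y] * u x + c b ^+ 2 * S
    = \sum_(b' <- bs) (c b' * b.[x] - c b * b'.[x]) * (c b' * b.[y] - c b * b'.[y]).
    rewrite /d /S /u mulr_suml !mulr_sumr -!sumrB -big_split /=.
    apply: eq_bigr => b1 _. ring.
  rewrite mulr_sumr; apply: eq_bigr => b' _.
  rewrite -k2 !horner_arith. ring.
rewrite -mulr_sumr !big_split /= -mulr_suml !sumrN -!mulr_suml -mulr_sumr -/S -/d -/(u x) -/(u y).
by field; rewrite (gt_eqF d0).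
Qed.

(** Schur complement with respect to the top coefficient. Comparing the coefficients of
    x^(n+1) in the defining identity of the kernel identifies its top row as the
    polynomial r. *)
Lemma psd_kernel_top_row (R : rcfType) (P Q : {poly R}) (n : nat) :
  psd_kernel P Q -> (size P <= n.+2)%N -> (size Q <= n.+2)%N ->
  let r := Q`_n.+1 *: P - P`_n.+1 *: Q in r != 0 ->
  0 < r`_n /\ exists bs, forall x y,
    P.[y] * Q.[x] - P.[x] * Q.[y]
    = (x - y) * ((r`_n)^-1 * (r.[x] * r.[y]) + gram bs x y).
Proof.
move=> [bs hbs] sP sQ r r0.
(* For each fixed y the identity is one between polynomials in x. *)
have hpoly y : P.[y] *: Q - Q.[y] *: P = ('X - y%:P) * \sum_(b <- bs) b.[y] *: b.
  apply: poly_ext => x; rewrite !horner_arith horner_sum.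
  rewrite [Q.[y] * _]mulrC hbs /gram; congr (_ * _).
  by apply: eq_bigr => b _; rewrite hornerZ mulrC.
have szS y : (size (\sum_(b <- bs) b.[y] *: b)%R <= n.+1)%N.
  have [->|S0] := eqVneq (\sum_(b <- bs) b.[y] *: b) 0; first by rewrite size_poly0.
  rewrite -ltnS -(size_XsubC_mul y S0) -hpoly (leq_trans (size_polyD _ _)) // geq_max.
  by rewrite size_polyN !(leq_trans (size_scale_leq _ _)).
have rE : r = \sum_(b <- bs) b`_n *: b.
  apply: poly_ext => y; rewrite /r.
  have := congr1 (fun p : {poly R} => p`_n.+1) (hpoly y).
  rewrite mulrBl mul_polyC !coefB !coefZ coefXM /= (nth_default _ (szS y)) mulr0 subr0.
  rewrite horner_sum coef_sum => e.
  rewrite !horner_arith [Q`_n.+1 * _]mulrC [P`_n.+1 * _]mulrC e.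
  by apply: eq_bigr => b _; rewrite coefZ hornerZ mulrC.
have dE : r`_n = \sum_(b <- bs) b`_n ^+ 2.
  by rewrite rE coef_sum; apply: eq_bigr => b _; rewrite coefZ expr2.
have d0 : 0 < r`_n.
  rewrite lt_def dE sumr_ge0 ?andbT; last by move=> b _; rewrite sqr_ge0.
  apply: contraNneq r0 => s0; rewrite rE big_seq big1 // => b bb.
  have := s0; move/eqP; rewrite psumr_eq0; last by move=> ? _; rewrite sqr_ge0.
  by move/allP/(_ _ bb); rewrite /= sqrf_eq0 => /eqP ->; rewrite scale0r.
split=> //; have [|bs' hbs'] := @schur_gram _ bs (fun b => b`_n); first by rewrite -dE.
by exists bs' => x y; rewrite hbs' -dE -rE addrCA subrr addr0 hbs.
Qed.

(** Schur complement with respect to the evaluation at a zero k of Q. The row of the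
    kernel at k is P(k) q, so the subtracted term is what the pole of P / Q at k
    contributes to the kernel. *)
Lemma stieltjes_root (R : rcfType) (P q : {poly R}) (k : R) :
  stieltjes P (('X - k%:P) * q) ->
  0 < P.[k] * q.[k] /\ exists bs, forall x y,
    P.[y] * (('X - k%:P) * q).[x] - P.[x] * (('X - k%:P) * q).[y]
    = (x - y) * (P.[k] / q.[k] * (q.[x] * q.[y]) + gram bs x y).
Proof.
set Q := _ * q => -[sPQ cPQ Q0 [bs hbs]].
have Pk : P.[k] != 0.
  apply/negP => /eqP Pk; have := coprimep_root cPQ; move/(_ k).
  by rewrite rootE Pk eqxx => /(_ isT); rewrite /Q !horner_arith subrr mul0r eqxx.
have q0 : q != 0.
  by apply: contra_eq_neq Q0 => q0; rewrite /Q q0 mulr0 horner0 eq_sym oner_neq0.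
have rE : P.[k] *: q = \sum_(b <- bs) b.[k] *: b.
  apply: (@mulfI _ ('X - k%:P)); first by rewrite polyXsubC_eq0.
  apply: poly_ext => x.
  have := hbs x k; rewrite /Q !horner_arith subrr !mul0r mulr0 subr0 horner_sum.
  rewrite mulrCA => ->; congr (_ * _).
  by apply: eq_bigr => b _; rewrite hornerZ mulrC.
have dE : P.[k] * q.[k] = \sum_(b <- bs) b.[k] ^+ 2.
  rewrite -hornerZ rE horner_sum; apply: eq_bigr => b _.
  by rewrite hornerZ expr2.
have d0 : 0 < P.[k] * q.[k].
  rewrite lt_def dE sumr_ge0 ?andbT; last by move=> b _; rewrite sqr_ge0.
  apply/negP => s0; have /eqP : P.[k] *: q = 0.
    rewrite rE big_seq big1 // => b bb.
    move: s0; rewrite psumr_eq0; last by move=> ? _; rewrite sqr_ge0.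
    by move/allP/(_ _ bb); rewrite /= sqrf_eq0 => /eqP ->; rewrite scale0r.
  by rewrite scale_poly_eq0 (negPf Pk) (negPf q0).
have qk : q.[k] != 0 by apply: contraTneq d0 => ->; rewrite mulr0 ltxx.
split=> //; have [|bs' hbs'] := @schur_gram _ bs (fun b => b.[k]); first by rewrite -dE.
exists bs' => x y; rewrite hbs' -dE -rE hbs !horner_arith; congr (_ * _); field.
by rewrite Pk qk.
Qed.

(** The residue of P / Q at k is P(k) / q(k), and it may be increased by any e that keeps
    it positive: what remains after removing the pole has a nonnegative kernel. *)
Lemma stieltjes_perturb (R : rcfType) (P q : {poly R}) (k e : R) :
  stieltjes P (('X - k%:P) * q) -> - (P.[k] / q.[k]) < e ->
  stieltjes (P + e *: q) (('X - k%:P) * q).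
Proof.
move=> st he; have [d0 [bs hbs]] := stieltjes_root st.
case: st => sPQ cPQ Q0 _.
have qk : q.[k] != 0 by apply: contraTneq d0 => ->; rewrite mulr0 ltxx.
have q0 : q != 0 by apply: contraNneq qk => ->; rewrite horner0.
split=> //.
- rewrite (leq_ltn_trans (size_polyD _ _)) // gtn_max sPQ.
  by rewrite (leq_ltn_trans (size_scale_leq _ _)) // size_XsubC_mul.
- move: cPQ; rewrite !coprimepMr => /andP[_ cPq]; apply/andP; split.
    rewrite coprimep_XsubC rootE !horner_arith /=; apply/negP => /eqP s0.
    have : P.[k] / q.[k] + e = 0.
      by apply: (mulIf qk); rewrite mulrDl divfK // s0 mul0r.
    by move/eqP; rewrite addrC addr_eq0 => /eqP ee; move: he; rewrite ee ltxx.
  by rewrite coprimep_sym -mul_polyC addrC coprimep_addl_mul coprimep_sym.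
exists (Num.sqrt (P.[k] / q.[k] + e) *: q :: bs) => x y.
have := hbs x y; rewrite /gram big_cons !horner_arith.
set S := \sum_(b <- bs) _ => h.
have -> : Num.sqrt (P.[k] / q.[k] + e) * q.[x] * (Num.sqrt (P.[k] / q.[k] + e) * q.[y])
  = (P.[k] / q.[k] + e) * (q.[x] * q.[y]).
  rewrite mulrACA -expr2 sqr_sqrtr //; lra.
have -> : (P.[y] + e * q.[y]) * ((x - k) * q.[x]) - (P.[x] + e * q.[x]) * ((y - k) * q.[y])
 = (P.[y] * ((x - k) * q.[x]) - P.[x] * ((y - k) * q.[y])) + (x - y) * e * (q.[x] * q.[y]) by ring.
rewrite h; ring.
Qed.

(** One step of the continued fraction of P / Q. Here l is the length, in the variable
    e^x, of the free interval before the first atom, and w, v are the weights of this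
    atom. Each of the two divisions is a Schur complement with respect to a top
    coefficient, which keeps the kernel positive and shows l > 0 and v >= 0. *)
Lemma stieltjes_peel (R : rcfType) (P Q : {poly R}) :
  stieltjes P Q -> (1 < size Q)%N ->
  exists l w v : R, exists P1 Q1 : {poly R},
    [/\ [/\ 0 < l, 0 <= v & 0 < `|w| + v], stieltjes P1 Q1, (size Q1 < size Q)%N,
        P = P1 - (w%:P + v *: 'X) * Q1 & Q = Q1 + l *: ('X * P)].
Proof.
move=> [sPQ cPQ Q0 kPQ] sQ.
have [n sQE] : exists n, size Q = n.+2 by case: (size Q) sQ => [|[|n]] // _; exists n.
have Qn : Q`_n.+1 != 0.
  by have := lead_coef_eq0 Q; rewrite lead_coefE sQE /= => ->; rewrite -size_poly_eq0 sQE.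
have sP : (size P <= n.+1)%N by rewrite -ltnS -sQE.
have P0 : P != 0.
  by apply: contraTneq cPQ => ->; rewrite coprime0p -size_poly_eq1 sQE.
have Pn1 : P`_n.+1 = 0 by rewrite nth_default.
have := psd_kernel_top_row kPQ (leq_trans sP (leqnSn _)).
rewrite sQE leqnn Pn1 scale0r subr0 => /(_ isT) /=.
rewrite scale_poly_eq0 negb_or Qn P0 coefZ => /(_ isT) [d0 [bs hbs]].
have Pn : P`_n != 0 by apply: contraTneq d0 => ->; rewrite mulr0 ltxx.
have sPE : size P = n.+1.
  by apply/eqP; rewrite eqn_leq sP; rewrite ltnNge; apply: contra Pn => /(nth_default 0) ->.
(* This l cancels the leading coefficient of Q. *)
pose l := Q`_n.+1 / P`_n.
have l0 : 0 < l.
  have -> : l = (Q`_n.+1 * P`_n) / P`_n ^+ 2 by rewrite /l; field.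
  by rewrite divr_gt0 // exprn_even_gt0.
pose Q1 := Q - l *: ('X * P).
have QE : Q = Q1 + l *: ('X * P) by rewrite subrK.
have Q10 : Q1.[0] = 1 by rewrite /Q1 !horner_arith mul0r mulr0 subr0.
have Q1n0 : Q1 != 0.
  by apply: contra_eq_neq Q10 => ->; rewrite horner0 eq_sym oner_neq0.
have sQ1 : (size Q1 <= n.+1)%N.
  apply/leq_sizeP => j; rewrite leq_eqVlt => /orP[/eqP <-|nj].
    by rewrite /Q1 coefB coefZ coefXM /= /l divfK ?subrr.
  rewrite /Q1 coefB coefZ coefXM nth_default ?sQE //.
  case: j nj => // j nj /=; rewrite nth_default ?mulr0 ?subrr //.
  by rewrite sPE.
have k1 : psd_kernel P Q1.
  exists bs => x y; have := hbs x y; rewrite /Q1 !horner_arith /l => h.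
  have -> : forall a b c d e : R, a * (b - e * (x * c)) - c * (d - e * (y * a)) =
     (a * b - c * d) - e * (x - y) * (c * a) by move=> *; ring.
  by rewrite h; field; rewrite Pn Qn.
have c1 : coprimep P Q1.
  move: cPQ. rewrite {1}QE -mul_polyC mulrA addrC. move=> hc.
  by move: hc; rewrite coprimep_addl_mul.
have sQ1Q : (size Q1 < n.+2)%N by [].
have csplit w v : coprimep (P + (w%:P + v *: 'X) * Q1) Q1.
  by rewrite coprimep_sym addrC coprimep_addl_mul coprimep_sym.
clearbody Q1.
have [Q1n|Q1n] := eqVneq Q1`_n 0; last first.
  have sQ1E : size Q1 = n.+1.
    by apply/eqP; rewrite eqn_leq sQ1; rewrite ltnNge; apply: contra Q1n => /(nth_default 0) ->.
  exists l, (- (P`_n / Q1`_n)), 0, (P - (P`_n / Q1`_n) *: Q1), Q1; split=> //.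
  - by split=> //; rewrite addr0 normr_gt0 oppr_eq0 mulf_eq0 invr_eq0 (negPf Pn).
  - split=> //.
    + rewrite sQ1E ltnS; apply/leq_sizeP => j; rewrite leq_eqVlt => /orP[/eqP <-|nj].
        by rewrite coefB coefZ divfK ?subrr.
      by rewrite coefB coefZ [P`_j]nth_default ?[Q1`_j]nth_default ?sQ1E ?sPE // mulr0 subrr.
    + by have := csplit (- (P`_n / Q1`_n)) 0; rewrite scale0r addr0 rmorphN mulNr mul_polyC.
    + case: k1 => bs1 hbs1; exists bs1 => x y; rewrite -hbs1 !horner_arith; ring.
  - by rewrite scale0r addr0 rmorphN mulNr opprK mul_polyC subrK.
have [m nE] : exists m, n = m.+1.
  case: (n) Q1n => [|m _]; last by exists m.
  by rewrite -horner_coef0 Q10 => /eqP; rewrite oner_eq0.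
move: (sQ1) Q1n Pn sPE sP; rewrite nE => sQ1' Q1n Pn' sPE' sP'.
have := psd_kernel_top_row k1 sP' sQ1' => /=.
rewrite Q1n scale0r sub0r oppr_eq0 scale_poly_eq0 (negPf Pn') (negPf Q1n0) => /(_ isT).
rewrite coefN coefZ => -[d1 [bs1 hbs1]].
have Q1m : Q1`_m != 0 by apply: contraTneq d1 => ->; rewrite mulr0 oppr0 ltxx.
(* The degree of Q1 has dropped by two, so the quotient of P by Q1 is linear, and v is minus
   its leading coefficient. *)
pose v := - (P`_m.+1 / Q1`_m).
have v0 : 0 < v.
  have -> : v = - (P`_m.+1 * Q1`_m) / Q1`_m ^+ 2 by rewrite /v; field.
  by rewrite divr_gt0 // exprn_even_gt0.
pose w := - ((P + v *: ('X * Q1))`_m / Q1`_m).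
exists l, w, v, (P + (w%:P + v *: 'X) * Q1), Q1; split=> //.
- by split=> //; [exact: ltW | exact: ltr_wpDl].
- split=> //; last first.
    exists bs1 => x y; have := hbs1 x y; rewrite !horner_arith => h.
    have -> : (P.[y] + (w + v * y) * Q1.[y]) * Q1.[x] - (P.[x] + (w + v * x) * Q1.[x]) * Q1.[y]
     = (P.[y] * Q1.[x] - P.[x] * Q1.[y]) - v * (x - y) * (Q1.[x] * Q1.[y]) by ring.
    by rewrite h /v; field; rewrite Pn' Q1m.
  have sQ1m : size Q1 = m.+1.
    apply/eqP; rewrite eqn_leq; apply/andP; split; last first.
      by rewrite ltnNge; apply: contra Q1m => /(nth_default 0) ->.
    apply/leq_sizeP => j; rewrite leq_eqVlt => /orP[/eqP <- //|nj].
    by rewrite nth_default // (leq_trans sQ1').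
  rewrite sQ1m ltnS; apply/leq_sizeP => j mj.
  have -> : P + (w%:P + v *: 'X) * Q1 = (P + v *: ('X * Q1)) + w *: Q1.
    by rewrite mulrDl mul_polyC scalerAl [in RHS]addrAC addrA.
  rewrite coefD (coefZ w).
  move: mj; rewrite leq_eqVlt => /orP[/eqP <-|mj].
    by rewrite /w mulNr divfK // subrr.
  rewrite (nth_default 0 (_ : size Q1 <= j)%N) ?sQ1m // mulr0 addr0.
  rewrite coefD coefZ coefXM; case: j mj => // j mj /=.
  move: mj; rewrite ltnS leq_eqVlt => /orP[/eqP <-|mj].
    by rewrite /v mulNr divfK // subrr.
  by rewrite [P`_j.+1]nth_default ?[Q1`_j]nth_default ?sQ1m ?sPE' ?mulr0 ?addr0.
- by rewrite addrK.
Qed.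

(** * The transfer of solutions across atoms *)

(** The coefficients (A, B) to the left of an atom at x, in terms of those to the right;
    t, ti stand for e^x, e^(-x), and h for the factor z w + z^2 v. *)
Definition jump (K : comNzRingType) (t ti h : K) (u : K * K) : K * K :=
  (u.1 + h * (u.1 + u.2 * ti), u.2 - h * (u.1 * t + u.2)).

Definition wronskian (K : comNzRingType) (u v : K * K) : K :=
  u.1 * v.2 - v.1 * u.2.

Lemma jumpK (K : comNzRingType) (t ti h : K) (u : K * K) :
  t * ti = 1 -> jump t ti (- h) (jump t ti h u) = u.
Proof.
move=> tti; case: u => a b; rewrite /jump /=; congr pair.
  rewrite [RHS](_ : _ = a + h * (h * (a * (1 - t * ti))) + h * (h * (b * ti * (1 - 1)))).
    ring: tti.
  by rewrite tti subrr !mulr0 !addr0.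
ring: tti.
Qed.

Lemma wronskian_jump (K : comNzRingType) (t ti h : K) (u v : K * K) :
  t * ti = 1 -> wronskian (jump t ti (- h) u) v = wronskian u (jump t ti h v).
Proof. by move=> tti; rewrite /wronskian /jump /=; ring: tti. Qed.

Definition hpoly (R : realType) (A : R * R * R) : {poly R} :=
  (womega A)%:P * 'X + (wv A)%:P * 'X^2.

(** The coefficients (A, B), near -oo, of the solution which is e^(-x/2) near +oo, as
    polynomials in z. *)
Definition pstate (R : realType) (s : seq (R * R * R)) : {poly R} * {poly R} :=
  foldr (fun A u => jump (expR (loc A))%:P (expR (- loc A))%:P (hpoly A) u) (0, 1) s.

Lemma pstate_cons (R : realType) (A : R * R * R) (s : seq (R * R * R)) :
  pstate (A :: s) = jump (expR (loc A))%:P (expR (- loc A))%:P (hpoly A) (pstate s).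
Proof. by []. Qed.

Definition reflect_atom (R : realType) (A : R * R * R) : R * R * R :=
  (- loc A, womega A, wv A).

Definition reflect (R : realType) (s : seq (R * R * R)) : seq (R * R * R) :=
  rev [seq reflect_atom A | A <- s].

(** The coefficients, near +oo, of the solution which is e^(x/2) near -oo: the reflection
    x -> -x exchanges the two coefficients. *)
Definition lstate (R : realType) (s : seq (R * R * R)) : {poly R} * {poly R} :=
  ((pstate (reflect s)).2, (pstate (reflect s)).1).

Definition admissible (R : realType) (s : seq (R * R * R)) : Prop :=
  [/\ sorted <%R [seq loc A | A <- s], {in s, forall A, 0 <= wv A} &
      {in s, forall A, 0 < `|womega A| + wv A}].

Definition degree (R : realType) (s : seq (R * R * R)) : nat :=
  (\sum_(A <- s) (if wv A == 0%R then 1 else 2))%N.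

Lemma expR_polyK (R : realType) (x : R) : (expR x)%:P * (expR (- x))%:P = 1.
Proof. by rewrite -rmorphM /= -expRD subrr expR0. Qed.

Lemma lstate_rcons (R : realType) (s : seq (R * R * R)) (A : R * R * R) :
  lstate (rcons s A) =
  jump (expR (loc A))%:P (expR (- loc A))%:P (- hpoly A) (lstate s).
Proof.
rewrite /lstate /reflect map_rcons rev_rcons /= /jump /= opprK.
rewrite (_ : hpoly (reflect_atom A) = hpoly A) // /reflect_atom /loc /=.
congr pair; ring.
Qed.

Lemma wronskian_split (R : realType) (s1 s2 : seq (R * R * R)) :
  wronskian (lstate s1) (pstate s2) = (pstate (s1 ++ s2)).2.
Proof.
elim/last_ind: s1 s2 => [|s1 A IH] s2.
  by rewrite /wronskian /lstate /reflect /= mul1r mulr0 subr0.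
by rewrite lstate_rcons wronskian_jump ?expR_polyK // cat_rcons -IH.
Qed.

(** At a zero of the characteristic polynomial the solutions decaying at the two ends are
    proportional, and their ratio can be read off near -oo. *)
Lemma pstate_lstate (R : realType) (s1 s2 : seq (R * R * R)) (x : R) :
  (pstate (s1 ++ s2)).2.[x] = 0 ->
  (pstate s2).1.[x] = (pstate (s1 ++ s2)).1.[x] * (lstate s1).1.[x] /\
  (pstate s2).2.[x] = (pstate (s1 ++ s2)).1.[x] * (lstate s1).2.[x].
Proof.
elim/last_ind: s1 s2 => [|s1 A IH] s2 Wx.
  by rewrite /lstate /reflect /= !horner_arith mulr1 mulr0; split.
move: Wx; rewrite cat_rcons => Wx.
have [e1 e2] := IH (A :: s2) Wx; rewrite lstate_rcons.
have hu := jumpK (hpoly A) (pstate s2) (expR_polyK (loc A)).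
move: e1 e2; rewrite pstate_cons; set u := jump _ _ (hpoly A) _ in hu *.
clearbody u; move=> e1 e2; rewrite -hu /jump /= !horner_arith e1 e2; split; ring.
Qed.

(** The polynomial whose value at a real point is the integral that defines gamma^2. *)
Fixpoint norm_sum (R : realType) (s : seq (R * R * R)) : {poly R} :=
  if s is A :: s' then
    (hpoly A)^`() * (expR (- loc A))%:P
      * ((pstate s').1 * (expR (loc A))%:P + (pstate s').2) ^+ 2 + norm_sum s'
  else 0.

(** The Lagrange identity, differentiated in the spectral parameter: the Wronskian of the
    state with its derivative changes across an atom only through the derivative of
    the weight. *)
Lemma pstate_lagrange (R : realType) (s : seq (R * R * R)) :
  norm_sum s = (pstate s).1^`() * (pstate s).2 - (pstate s).1 * (pstate s).2^`().
Proof.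
elim: s => [|A s IH] /=; first by rewrite deriv0 !mul0r subrr.
rewrite IH; have := expR_polyK (loc A).
rewrite !(derivD, derivN, derivM, derivC).
set t := (expR _)%:P; set ti := (expR _)%:P => tti.
set a := (pstate s).1; set b := (pstate s).2.
rewrite !mulr0 !addr0; ring: tti.
Qed.

(** * Half-lines and their Weyl functions *)

(** Up to a factor e^(a/2), the value at a of the solution decaying at +oo. *)
Definition Qright (R : realType) (a : R) (s : seq (R * R * R)) : {poly R} :=
  (pstate s).1 * (expR a)%:P + (pstate s).2.

(** Up to a factor e^(-a/2), the value at a of the solution decaying at -oo. *)
Definition Qleft (R : realType) (a : R) (s : seq (R * R * R)) : {poly R} :=
  (lstate s).1 + (lstate s).2 * (expR (- a))%:P.

Lemma admissible_cons (R : realType) (A : R * R * R) (s : seq (R * R * R)) :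
  admissible (A :: s) <->
  [/\ admissible s, {in s, forall B, loc A < loc B}, 0 <= wv A & 0 < `|womega A| + wv A].
Proof.
rewrite /admissible /= (path_sortedE lt_trans) all_map; split.
  move=> [/andP[/allP h1 h2] h3 h4]; split.
  - split=> // B sB; [apply: h3|apply: h4]; by rewrite inE sB orbT.
  - by move=> B /h1.
  - by apply: h3; rewrite mem_head.
  - by apply: h4; rewrite mem_head.
move=> [[h1 h2 h3] h4 h5 h6]; split.
- by rewrite h1 andbT; apply/allP => B /h4.
- by move=> B; rewrite inE => /predU1P[->|/h2].
- by move=> B; rewrite inE => /predU1P[->|/h3].
Qed.

Lemma degree_cons (R : realType) (A : R * R * R) (s : seq (R * R * R)) :
  degree (A :: s) = ((if wv A == 0%R then 1 else 2) + degree s)%N.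
Proof. by rewrite /degree big_cons. Qed.

(** The inverse of [stieltjes_peel]: the atom and the interval add v Q1(x) Q1(y) and l
    P(x) P(y) to the kernel. *)
Lemma stieltjes_attach (R : rcfType) (P1 Q1 : {poly R}) (l w v : R) :
  stieltjes P1 Q1 -> 0 < l -> 0 <= v -> 0 < `|w| + v ->
  let P := P1 - (w%:P + v *: 'X) * Q1 in let Q := Q1 + l *: ('X * P) in
  stieltjes P Q /\ size Q = ((if v == 0%R then 1 else 2) + size Q1)%N.
Proof.
move=> [sPQ cPQ Q0 [bs hbs]] l0 v0 wv0 P Q.
have Q1n0 : Q1 != 0 by rewrite -size_poly_gt0 (leq_ltn_trans _ sPQ).
have sP : size P = ((if v == 0%R then 0 else 1) + size Q1)%N.
  have sM : size ((w%:P + v *: 'X) * Q1) = ((if v == 0%R then 0 else 1) + size Q1)%N.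
    have [ve|vn] := eqVneq v 0.
      rewrite ve scale0r addr0 mul_polyC size_scale //.
      by move: wv0; rewrite ve addr0 normr_gt0.
    have sv : size (w%:P + v *: 'X) = 2%N.
      rewrite addrC size_polyDl size_scale // ?size_polyX //.
      by rewrite (leq_ltn_trans (size_polyC_leq1 _)).
    by rewrite size_mul // ?sv // -size_poly_gt0 sv.
  rewrite /P addrC size_polyDl size_polyN sM //.
  by rewrite (leq_trans sPQ) // leq_addl.
have P0 : P != 0.
  by rewrite -size_poly_gt0 sP ltn_addl // size_poly_gt0.
have sX : size (l *: ('X * P)) = (size P).+1.
  by rewrite size_scale ?gt_eqF // mulrC size_mulX.
have sQ : size Q = (size P).+1.
  rewrite /Q addrC size_polyDl sX // ltnS sP leq_addl //.
split; last by rewrite sQ sP; case: (v == 0).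
have c1 : coprimep P Q1.
  by rewrite coprimep_sym /P addrC -mulNr coprimep_addl_mul coprimep_sym.
split.
- by rewrite sQ.
- by rewrite /Q -mul_polyC mulrA addrC coprimep_addl_mul.
- by rewrite /Q !horner_arith mul0r mulr0 addr0.
exists (Num.sqrt v *: Q1 :: Num.sqrt l *: P :: bs) => x y.
have := hbs x y; rewrite /gram !big_cons; set S := \sum_(b <- bs) _ => h.
have Q1E z : Q.[z] = Q1.[z] + l * (z * P.[z]) by rewrite /Q !horner_arith.
have PE z : P1.[z] = P.[z] + (w + v * z) * Q1.[z] by rewrite /P !horner_arith subrK.
move: h; rewrite !Q1E !PE !hornerZ => h.
have -> : P.[y] * (Q1.[x] + l * (x * P.[x])) - P.[x] * (Q1.[y] + l * (y * P.[y]))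
  = ((P.[y] + (w + v * y) * Q1.[y]) * Q1.[x] -
      (P.[x] + (w + v * x) * Q1.[x]) * Q1.[y]) + (x - y) * (v * (Q1.[x] * Q1.[y])
   + l * (P.[x] * P.[y])) by ring.
rewrite h.
have sq c p q : 0 <= c -> Num.sqrt c * p * (Num.sqrt c * q) = c * (p * q).
  by move=> c0; rewrite mulrACA -expr2 sqr_sqrtr.
rewrite !sq ?(ltW l0) //; ring.
Qed.

(** In the variable t = e^x the function A t + B is piecewise linear, so each atom
    together with the interval before it is one application of [stieltjes_attach]. The
    value t = 0 is allowed and describes the behaviour at -oo. *)
Lemma half_line_stieltjes (R : realType) (s : seq (R * R * R)) (t : R) :
  admissible s -> {in s, forall A, t < expR (loc A)} ->
  exists P, [/\ stieltjes P ((pstate s).1 * t%:P + (pstate s).2),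
    (pstate s).1 = - ('X * P) &
    size ((pstate s).1 * t%:P + (pstate s).2) = (degree s).+1].
Proof.
elim: s t => [|A s IH] t /=.
  move=> _ _; exists 0; rewrite mulr0 oppr0 mul0r add0r /degree big_nil; split=> //; last first.
    by rewrite size_poly1.
  split; rewrite ?size_poly0 ?size_poly1 ?coprimep1 ?horner_arith //.
  by exists [::] => x y; rewrite /gram big_nil !horner_arith mulr0 mul0r subrr.
move=> /admissible_cons[ads lts v0 wv0] tA.
have [B sB|P1 [st A1 sz]] := IH (expR (loc A)) ads.
  by rewrite ltr_expR lts.
have tA1 : t < expR (loc A) by apply: tA; rewrite mem_head.
set T := expR (loc A) in st sz tA1 *.
have T0 : 0 < T by exact: expR_gt0.
have Ti : expR (- loc A) = T^-1 by rewrite expRN.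
set Q1 := (pstate s).1 * T%:P + (pstate s).2 in st sz *.
pose w := womega A / T; pose v := wv A / T; pose l := T - t.
have l0 : 0 < l by rewrite subr_gt0.
have v0' : 0 <= v by rewrite divr_ge0 // ltW.
have wv0' : 0 < `|w| + v.
  by rewrite /w /v normrM normfV (gtr0_norm T0) -mulrDl divr_gt0.
have [st' sz'] := stieltjes_attach st l0 v0' wv0'.
set P := P1 - (w%:P + v *: 'X) * Q1 in st' sz'.
have TT : T%:P * T^-1%:P = 1 :> {poly R} by rewrite -rmorphM /= divff ?gt_eqF.
have hE' : hpoly A * (T^-1)%:P = 'X * (w%:P + v *: 'X).
  rewrite /hpoly /w /v -!mul_polyC !rmorphM /=; ring.
have PE : (pstate s).1 + hpoly A * ((pstate s).1 + (pstate s).2 * (T^-1)%:P) = - ('X * P).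
  have -> : (pstate s).1 + (pstate s).2 * T^-1%:P = Q1 * T^-1%:P.
    by rewrite mulrDl -mulrA TT mulr1.
  have -> : hpoly A * (Q1 * T^-1%:P) = hpoly A * T^-1%:P * Q1 by ring.
  by rewrite hE' A1 /P; ring.
have QE : (- ('X * P)) * t%:P + ((pstate s).2 - hpoly A * ((pstate s).1 * T%:P + (pstate s).2))
    = Q1 + l *: ('X * P).
  have -> : 'X * P = - ((pstate s).1 + hpoly A * ((pstate s).1 + (pstate s).2 * T^-1%:P)).
    by rewrite PE opprK.
  rewrite /l -mul_polyC rmorphB /= /Q1; ring: TT.
exists P; rewrite Ti -/T PE QE; split=> //.
by rewrite sz' sz degree_cons /v mulf_eq0 invr_eq0 (gt_eqF T0) orbF addnS.
Qed.

(** Every pair of polynomials with a positive kernel arises from finitely many atoms: each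
    [stieltjes_peel] yields the first atom and lowers the degree of Q. *)
Lemma half_line_inverse (R : realType) (P Q : {poly R}) (t : R) :
  0 <= t -> stieltjes P Q ->
  exists s, [/\ admissible s, {in s, forall A, t < expR (loc A)},
    (pstate s).1 = - ('X * P) & (pstate s).1 * t%:P + (pstate s).2 = Q].
Proof.
move: {2}(size Q) (leqnn (size Q)) => n.
elim: n P Q t => [|n IH] P Q t sQ t0 st.
  by have [sPQ _ _ _] := st; move: (leq_trans sPQ sQ); rewrite ltn0.
have [sQ1|sQ1] := leqP (size Q) 1.
  have [sPQ _ Q0 _] := st; exists [::]; split=> //=; rewrite ?mul0r ?add0r.
    have := leq_trans sPQ sQ1; rewrite ltnS leqn0 size_poly_eq0 => /eqP ->.
    by rewrite mulr0 oppr0.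
  by have := size1_polyC sQ1; rewrite -horner_coef0 Q0.
have [l [w [v [P1 [Q1 [[l0 v0 wv0] st1 sQ1Q PE QE]]]]]] := stieltjes_peel st sQ1.
pose T := t + l; have T0 : 0 < T by rewrite ltr_wpDl.
have [|s [ads ts s1 s2]] := IH P1 Q1 T _ (ltW T0) st1.
  by rewrite -ltnS (leq_trans sQ1Q).
have lnT : expR (ln T) = T by rewrite lnK.
pose A : R * R * R := (ln T, w * T, v * T).
have TT : T%:P * T^-1%:P = 1 :> {poly R} by rewrite -rmorphM /= divff ?gt_eqF.
have eA : expR (loc A) = T by rewrite /loc /= lnT.
have eAi : expR (- loc A) = T^-1 by rewrite expRN eA.
have hA : hpoly A = 'X * (w%:P + v *: 'X) * T%:P.
  by rewrite /hpoly /womega /wv /= !rmorphM -mul_polyC /=; ring.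
have st2 : (pstate s).1 + (pstate s).2 * T^-1%:P = Q1 * T^-1%:P.
  by rewrite -s2 mulrDl -mulrA TT mulr1.
exists (A :: s).
have PE' : (pstate (A :: s)).1 = - ('X * P).
  rewrite pstate_cons /jump /= eAi st2 s1 PE hA; ring: TT.
split=> //.
- apply/admissible_cons; split=> //.
  + by move=> B /ts tB; rewrite -ltr_expR eA.
  + by rewrite /wv /= mulr_ge0 // ltW.
  + by rewrite /wv /womega /= normrM (gtr0_norm T0) -mulrDl mulr_gt0.
- move=> B; rewrite inE => /predU1P[->|/ts].
    by rewrite eA ltrDl.
  by apply: lt_trans; rewrite ltrDl.
rewrite pstate_cons /jump /= eA eAi st2 s2 s1 QE PE hA -!mul_polyC.
have -> : l%:P = T%:P - t%:P :> {poly R} by rewrite -rmorphB /= /T addrC addKr.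
have -> : (pstate s).2 = Q1 - (pstate s).1 * T%:P by rewrite -s2 addrC addKr.
rewrite s1; ring: TT.
Qed.

Lemma admissible_cat (R : realType) (s1 s2 : seq (R * R * R)) :
  admissible (s1 ++ s2) <->
  [/\ admissible s1, admissible s2 & {in s1 & s2, forall A B, loc A < loc B}].
Proof.
elim: s1 => [|A s1 IH] /=; first by split=> [h|[_ h _] //]; split.
split.
  move=> /admissible_cons[/IH[h1 h2 h3] h4 h5 h6]; split=> //.
    by apply/admissible_cons; split=> // B sB; apply: h4; rewrite mem_cat sB.
  move=> B C; rewrite inE => /predU1P[->|sB] sC; last exact: h3.
  by apply: h4; rewrite mem_cat sC orbT.
move=> [/admissible_cons[h1 h2 h3 h4] h5 h6]; apply/admissible_cons; split=> //.
  by apply/IH; split=> // B C sB sC; apply: h6 => //; rewrite inE sB orbT.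
move=> B; rewrite mem_cat => /orP[/h2//|sB].
by apply: h6 => //; rewrite mem_head.
Qed.

Lemma mem_reflect (R : realType) (s : seq (R * R * R)) (B : R * R * R) :
  B \in reflect s -> exists2 A, A \in s & B = reflect_atom A.
Proof. by rewrite mem_rev => /mapP. Qed.

Lemma admissible_reflect (R : realType) (s : seq (R * R * R)) :
  admissible s -> admissible (reflect s).
Proof.
elim: s => [//|A s IH] /admissible_cons[/IH h1 h2 h3 h4].
rewrite /reflect /= rev_cons -cats1; apply/admissible_cat; split=> //.
  by apply/admissible_cons; split.
move=> B C /mem_reflect[D sD ->]; rewrite inE => /eqP ->.
by rewrite /loc /= ltrN2 h2.
Qed.

Lemma reflectK (R : realType) : involutive (@reflect R).
Proof.
move=> s; rewrite /reflect map_rev revK -map_comp map_id_in // => -[[x w] v] _.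
by rewrite /reflect_atom /= /loc /= opprK.
Qed.

Lemma degree_reflect (R : realType) (s : seq (R * R * R)) :
  degree (reflect s) = degree s.
Proof. by rewrite /degree (perm_big _ (permEl (perm_rev _))) big_map. Qed.

Lemma Qleft_reflect (R : realType) (a : R) (s : seq (R * R * R)) :
  Qleft a s = Qright (- a) (reflect s).
Proof. by rewrite /Qleft /Qright /lstate /= addrC. Qed.

Lemma right_stieltjes (R : realType) (a : R) (s : seq (R * R * R)) :
  admissible s -> {in s, forall A, a < loc A} ->
  exists P, [/\ stieltjes P (Qright a s), (pstate s).1 = - ('X * P) &
    size (Qright a s) = (degree s).+1].
Proof.
move=> ads sa; apply: half_line_stieltjes => // A sA.
by rewrite ltr_expR sa.
Qed.

Lemma right_inverse (R : realType) (a : R) (P Q : {poly R}) :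
  stieltjes P Q ->
  exists s, [/\ admissible s, {in s, forall A, a < loc A},
    (pstate s).1 = - ('X * P) & Qright a s = Q].
Proof.
move=> /(half_line_inverse (ltW (expR_gt0 a)))[s [ads sa s1 s2]].
by exists s; split=> // A sA; rewrite -ltr_expR sa.
Qed.

Lemma left_stieltjes (R : realType) (a : R) (s : seq (R * R * R)) :
  admissible s -> {in s, forall A, loc A < a} ->
  exists P, [/\ stieltjes P (Qleft a s), (lstate s).2 = - ('X * P) &
    size (Qleft a s) = (degree s).+1].
Proof.
move=> /admissible_reflect ads sa.
rewrite Qleft_reflect -degree_reflect; apply: right_stieltjes => // B.
by move=> /mem_reflect[A sA ->]; rewrite /loc /= ltrN2 sa.
Qed.

Lemma left_inverse (R : realType) (a : R) (P Q : {poly R}) :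
  stieltjes P Q ->
  exists s, [/\ admissible s, {in s, forall A, loc A < a},
    (lstate s).2 = - ('X * P) & Qleft a s = Q].
Proof.
move=> /(right_inverse (- a))[s [ads sa s1 s2]]; exists (reflect s).
rewrite Qleft_reflect /lstate reflectK; split=> //; first exact: admissible_reflect.
by move=> B /mem_reflect[A sA ->]; rewrite /loc /= ltrNl sa.
Qed.

(** * Gluing two half-lines *)

(** The matrices of atoms at one and the same point commute, and the product of their
    nilpotent parts vanishes; hence only the total weight matters. *)
Lemma jump_center (R : realType) (a : R) (c s : seq (R * R * R)) :
  {in c, forall A, loc A = a} ->
  pstate (c ++ s) =
  ((pstate s).1 + (\sum_(A <- c) hpoly A) * (expR (- a))%:P * Qright a s,
   (pstate s).2 - (\sum_(A <- c) hpoly A) * Qright a s).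
Proof.
elim: c => [|A c IH] ca.
  by rewrite big_nil !mul0r addr0 subr0 /=; case: (pstate s).
rewrite cat_cons pstate_cons IH; last by move=> B cB; apply: ca; rewrite inE cB orbT.
rewrite (ca A) ?mem_head // big_cons /jump /Qright /=.
have := expR_polyK a; set t := (expR a)%:P; set ti := (expR (- a))%:P => tti.
set H := \sum_(_ <- _) _.
congr pair; ring: tti.
Qed.

Lemma Qright_center (R : realType) (a : R) (c s : seq (R * R * R)) :
  {in c, forall A, loc A = a} -> Qright a (c ++ s) = Qright a s.
Proof.
move=> ca; rewrite {1}/Qright (jump_center _ ca) /=.
have := expR_polyK a; rewrite /Qright.
set t := (expR a)%:P; set ti := (expR (- a))%:P => tti; ring: tti.
Qed.

Lemma charpoly_center (R : realType) (a : R) (s1 c s2 : seq (R * R * R)) :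
  {in c, forall A, loc A = a} ->
  (pstate (s1 ++ c ++ s2)).2 = wronskian (lstate s1) (pstate s2)
    - (\sum_(A <- c) hpoly A) * (Qleft a s1 * Qright a s2).
Proof.
move=> ca; rewrite -wronskian_split (jump_center _ ca) /wronskian /Qleft /=.
ring.
Qed.

Lemma charpoly_stieltjes (R : realType) (mu : seq (R * R * R)) :
  admissible mu ->
  exists P, [/\ stieltjes P (pstate mu).2, (pstate mu).1 = - ('X * P) &
    size (pstate mu).2 = (degree mu).+1].
Proof.
move=> ad; have [|P] := half_line_stieltjes (t := 0) ad.
  by move=> A _; exact: expR_gt0.
by rewrite mulr0 add0r => h; exists P.
Qed.

(** This is lambda gamma_lambda^2 when x is an eigenvalue lambda. *)
Definition coupling (R : realType) (mu : seq (R * R * R)) (x : R) : R :=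
  - (x * (pstate mu).1.[x] * (pstate mu).2^`().[x]).

Lemma root_factor (R : fieldType) (Q : {poly R}) (k : R) :
  Q.[k] = 0 -> exists q, Q = ('X - k%:P) * q /\ Q^`().[k] = q.[k].
Proof.
move=> /eqP; rewrite -rootE => /factor_theorem[q ->]; exists q; rewrite mulrC; split=> //.
by rewrite derivM derivXsubC mul1r !hornerE subrr mul0r addr0.
Qed.

Lemma charpoly0 (R : realType) (mu : seq (R * R * R)) :
  admissible mu -> (pstate mu).2.[0] = 1.
Proof. by move=> /charpoly_stieltjes[P [[]]]. Qed.

Lemma charroot_neq0 (R : realType) (mu : seq (R * R * R)) (k : R) :
  admissible mu -> (pstate mu).2.[k] = 0 -> k != 0.
Proof.
by move=> /charpoly0 h; apply: contra_eq_neq => ->; rewrite h oner_neq0.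
Qed.

(** At the end -oo of the line, the positive quantity P(k) Q'(k) of [stieltjes_root] is
    the coupling constant divided by k^2. *)
Lemma coupling_gt0 (R : realType) (mu : seq (R * R * R)) (k : R) :
  admissible mu -> (pstate mu).2.[k] = 0 -> 0 < coupling mu k.
Proof.
move=> ad Wk; have k0 := charroot_neq0 ad Wk.
have [P [st A0 _]] := charpoly_stieltjes ad.
have [q [WE dW]] := root_factor Wk.
rewrite /coupling dW A0; rewrite WE in st.
have [d0 _] := stieltjes_root st.
have -> : - (k * (- ('X * P)).[k] * q.[k]) = k ^+ 2 * (P.[k] * q.[k]).
  rewrite !horner_arith; ring.
by rewrite mulr_gt0 // exprn_even_gt0.
Qed.

Lemma Qright_Qleft (R : realType) (a : R) (s1 c s2 : seq (R * R * R)) (k : R) :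
  {in c, forall A, loc A = a} -> (pstate (s1 ++ c ++ s2)).2.[k] = 0 ->
  (Qright a s2).[k] = (pstate (s1 ++ c ++ s2)).1.[k] * expR a * (Qleft a s1).[k].
Proof.
move=> ca Wk; have [e1 e2] := pstate_lstate Wk.
rewrite -(Qright_center s2 ca) /Qright /Qleft !horner_arith e1 e2 expRN.
by field; rewrite gt_eqF ?expR_gt0.
Qed.

(** At a common zero of both half-line polynomials the proportionality of the two decaying
    solutions is visible in their derivatives at a only. *)
Lemma Pright_Pleft (R : realType) (a : R) (s1 c s2 : seq (R * R * R)) (k : R)
    (Pl Pr : {poly R}) :
  {in c, forall A, loc A = a} -> k != 0 -> (pstate (s1 ++ c ++ s2)).2.[k] = 0 ->
  (pstate s2).1 = - ('X * Pr) -> (lstate s1).2 = - ('X * Pl) ->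
  (Qleft a s1).[k] = 0 ->
  (pstate (s1 ++ c ++ s2)).1.[k] * Pl.[k] = - (expR a * Pr.[k]).
Proof.
move=> ca k0 Wk er el Qk; have [e1 _] := pstate_lstate Wk.
have Qrk := Qright_Qleft ca Wk; rewrite Qk mulr0 in Qrk.
move: e1; rewrite (jump_center _ ca) /= hornerD hornerM Qrk mulr0 addr0 er.
move: Qk; rewrite /Qleft hornerD hornerM el !horner_arith expRN => Qk.
have -> : (lstate s1).1.[k] = k * Pl.[k] / expR a.
  by move/eqP: Qk; rewrite mulNr subr_eq0 => /eqP.
move=> e; apply: (mulfI k0).
have : - (k * Pr.[k]) * expR a = (pstate (s1 ++ (c ++ s2))).1.[k] * (k * Pl.[k]).
  by rewrite e mulrA mulfVK // gt_eqF ?expR_gt0.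
by move=> h; rewrite mulrCA -h; ring.
Qed.

(** A multiple of Qright / (X - k) is added to the right numerator and the corresponding
    multiple of Qleft / (X - k) is subtracted from the left one. The contributions to
    the characteristic polynomial cancel, and the coupling constant at k is
    proportional to the ratio of the two residues, which takes every positive value. *)
Lemma redistribute (R : realType) (a k g : R) (s1 c s2 : seq (R * R * R)) :
  admissible (s1 ++ c ++ s2) ->
  {in s1, forall A, loc A < a} -> {in c, forall A, loc A = a} ->
  {in s2, forall A, a < loc A} ->
  (Qleft a s1).[k] = 0 -> (Qright a s2).[k] = 0 -> 0 < g ->
  exists t1 t2, [/\ admissible (t1 ++ c ++ t2),
    {in t1, forall A, loc A < a} /\ {in t2, forall A, a < loc A},
    Qleft a t1 = Qleft a s1 /\ Qright a t2 = Qright a s2,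
    (pstate (t1 ++ c ++ t2)).2 = (pstate (s1 ++ c ++ s2)).2 &
    coupling (t1 ++ c ++ t2) k = g /\
    forall x, (pstate (s1 ++ c ++ s2)).2.[x] = 0 -> x != k ->
      coupling (t1 ++ c ++ t2) x = coupling (s1 ++ c ++ s2) x].
Proof.
move=> ad l1 ca l2 Qlk Qrk g0.
have [ad1 /admissible_cat[adc ad2 _] _] := (admissible_cat _ _).1 ad.
have [Pl [stl el _]] := left_stieltjes ad1 l1.
have [Pr [str er _]] := right_stieltjes ad2 l2.
set W := (pstate (s1 ++ c ++ s2)).2.
have WE : W = Qleft a s1 * Qright a s2 + 'X * ((expR a)%:P * Pr * Qleft a s1
   + (expR (- a))%:P * Pl * Qright a s2)
   - (\sum_(A <- c) hpoly A) * (Qleft a s1 * Qright a s2).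
  rewrite /W (charpoly_center _ _ ca); congr (_ - _).
  rewrite /wronskian /Qleft /Qright el er.
  have := expR_polyK a; set t := (expR a)%:P; set ti := (expR (- a))%:P => tti.
  ring: tti.
have Wk : W.[k] = 0.
  rewrite WE; move: Qlk Qrk; move: (Qleft a s1) (Qright a s2) => u v h1 h2.
  by rewrite !horner_arith h1 h2; ring.
have k0 := charroot_neq0 ad Wk.
have cg := coupling_gt0 ad Wk.
have [ql [QlE dQl]] := root_factor Qlk.
have [qr [QrE dQr]] := root_factor Qrk.
rewrite QlE in stl; rewrite QrE in str.
have [dl _] := stieltjes_root stl; have [dr _] := stieltjes_root str.
have qlk : ql.[k] != 0 by apply: contraTneq dl => ->; rewrite mulr0 ltxx.
have qrk : qr.[k] != 0 by apply: contraTneq dr => ->; rewrite mulr0 ltxx.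
have Plk : Pl.[k] != 0 by apply: contraTneq dl => ->; rewrite mul0r ltxx.
have pos_div x y : y != 0 -> 0 < x * y -> 0 < x / y :> R.
  move=> y0 xy; have -> : x / y = x * y / y ^+ 2 by field.
  by rewrite divr_gt0 // exprn_even_gt0.
pose cl := Pl.[k] / ql.[k]; pose cr := Pr.[k] / qr.[k].
have cl0 : 0 < cl by exact: pos_div.
have cr0 : 0 < cr by exact: pos_div.
pose t := expR a; have t0 : 0 < t by exact: expR_gt0.
pose M := k * t * W^`().[k] * qr.[k] / ql.[k].
have gE : coupling (s1 ++ c ++ s2) k = M * cr / cl.
  have e := Pright_Pleft ca k0 Wk er el Qlk.
  have -> : coupling (s1 ++ c ++ s2) k
     = - (k * ((pstate (s1 ++ c ++ s2)).1.[k] * Pl.[k]) * W^`().[k]) / Pl.[k].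
    by rewrite /coupling -/W; field.
  by rewrite e /M /cl /cr -/t; field; rewrite qlk qrk Plk.
have M0 : 0 < M.
  have -> : M = coupling (s1 ++ c ++ s2) k * cl / cr by rewrite gE; field; rewrite !gt_eqF.
  by rewrite divr_gt0 // mulr_gt0.
pose rho := g / M; have rho0 : 0 < rho by exact: divr_gt0.
have den0 : 0 < 1 + rho * t ^+ 2 by rewrite addr_gt0 // mulr_gt0 // exprn_gt0.
(* The solution of (cr + e / t) / (cl - e * t) = rho. *)
pose e := (rho * cl - cr) * t / (1 + rho * t ^+ 2).
have crE : cr + e / t = rho * (t ^+ 2 * cr + cl) / (1 + rho * t ^+ 2).
  by rewrite /e; field; rewrite !gt_eqF.
have clE : cl - e * t = (t ^+ 2 * cr + cl) / (1 + rho * t ^+ 2).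
  by rewrite /e; field; rewrite !gt_eqF.
have num0 : 0 < t ^+ 2 * cr + cl by rewrite addr_gt0 // mulr_gt0 // exprn_gt0.
have str' : stieltjes (Pr + (e / t) *: qr) (Qright a s2).
  rewrite QrE; apply: stieltjes_perturb => //; rewrite -/cr -subr_gt0 opprK addrC crE.
  by rewrite divr_gt0 // mulr_gt0.
have stl' : stieltjes (Pl - (e * t) *: ql) (Qleft a s1).
  rewrite QlE -scaleNr; apply: stieltjes_perturb => //; rewrite -/cl.
  by rewrite ltrN2 -subr_gt0 clE divr_gt0.
have [t1 [adt1 lt1 et1 Qt1]] := left_inverse a stl'.
have [t2 [adt2 lt2 et2 Qt2]] := right_inverse a str'.
have tE : (e / t)%:P * (expR a)%:P = e%:P :> {poly R}.
  by rewrite -rmorphM /= divfK // gt_eqF.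
have tE' : (e * t)%:P * (expR (- a))%:P = e%:P :> {poly R}.
  by rewrite -rmorphM /= expRN mulfK // gt_eqF.
(* The two perturbations are matched by f T = e = f' Ti, so they cancel in the
   characteristic polynomial. *)
have W' : (pstate (t1 ++ c ++ t2)).2 = W.
  rewrite WE (charpoly_center _ _ ca) Qt1 Qt2; congr (_ - _).
  have et1' : (lstate t1).1 = Qleft a s1 - (lstate t1).2 * (expR (- a))%:P.
    by rewrite -Qt1 /Qleft addrK.
  have et2' : (pstate t2).2 = Qright a s2 - (pstate t2).1 * (expR a)%:P.
    by rewrite -Qt2 /Qright addrC addKr.
  rewrite /wronskian et1' et2' et1 et2.
  have := expR_polyK a; move: tE tE'.
  rewrite -[(e / t) *: _]mul_polyC -[(e * t) *: _]mul_polyC.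
  rewrite QlE QrE.
  move: (expR a)%:P (expR (- a))%:P (e / t)%:P (e * t)%:P => T Ti f f' hf hf' TTi.
  rewrite [LHS](_ : _ = ('X - k%:P) * ql * (('X - k%:P) * qr) +
    'X * (T * Pr * (('X - k%:P) * ql) + Ti * Pl * (('X - k%:P) * qr))
    + 'X * (('X - k%:P) * ql * qr) * (f * T - f' * Ti)
    + (T * Ti - 1) * ('X ^+ 2 * (Pr + f * qr) * (Pl - f' * ql))); last by ring.
  by rewrite hf hf' TTi; ring.
exists t1, t2; split=> //.
- apply/admissible_cat; split=> //.
    apply/admissible_cat; split=> // A B cA tB; rewrite (ca _ cA); exact: lt2.
  move=> A B tA; rewrite mem_cat => /orP[cB|tB]; first by rewrite (ca _ cB) lt1.
  exact: (lt_trans (lt1 _ tA) (lt2 _ tB)).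
have Qt1k : (Qleft a t1).[k] = 0 by rewrite Qt1.
split.
  have Wtk : (pstate (t1 ++ c ++ t2)).2.[k] = 0 by rewrite W'.
  have h := Pright_Pleft ca k0 Wtk et2 et1 Qt1k.
  move: h; rewrite !horner_arith.
  have -> : Pl.[k] - e * t * ql.[k] = ql.[k] * (cl - e * t) by rewrite /cl; field.
  have -> : Pr.[k] + e / t * qr.[k] = qr.[k] * (cr + e / t).
    by rewrite /cr; field; rewrite qrk gt_eqF.
  have cl1 : cl - e * t != 0 by rewrite clE gt_eqF // divr_gt0.
  have -> : cr + e / t = rho * (cl - e * t) by rewrite crE clE mulrA.
  move=> h.
  have -> : coupling (t1 ++ c ++ t2) k
     = - (k * ((pstate (t1 ++ c ++ t2)).1.[k] * (ql.[k] * (cl - e * t))) * W^`().[k])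
        / (ql.[k] * (cl - e * t)).
    by rewrite /coupling W'; field; rewrite qlk cl1.
  rewrite h -/t.
  have -> : g = M * rho by rewrite /rho mulrC divfK // gt_eqF.
  by rewrite /M; field; rewrite qlk cl1.
move=> x Wx xk; rewrite /coupling W'; congr (- (_ * _ * _)).
have Wtx : (pstate (t1 ++ c ++ t2)).2.[x] = 0 by rewrite W'.
have x0 := charroot_neq0 ad Wx.
have [Qlx|Qlx] := eqVneq (Qleft a s1).[x] 0; last first.
  have h1 := Qright_Qleft ca Wx; have h2 := Qright_Qleft ca Wtx.
  move: h2; rewrite Qt1 Qt2 h1.
  by move=> /(mulIf Qlx)/(mulIf (lt0r_neq0 t0)) ->.
have Qrx : (Qright a s2).[x] = 0 by rewrite (Qright_Qleft ca Wx) Qlx mulr0.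
have h1 := Pright_Pleft ca x0 Wx er el Qlx.
have Qt1x : (Qleft a t1).[x] = 0 by rewrite Qt1.
have h2 := Pright_Pleft ca x0 Wtx et2 et1 Qt1x.
have xk' : x - k != 0 by rewrite subr_eq0.
have qlx : ql.[x] = 0.
  by move: Qlx; rewrite QlE !horner_arith => /eqP; rewrite mulf_eq0 (negPf xk') => /eqP.
have qrx : qr.[x] = 0.
  by move: Qrx; rewrite QrE !horner_arith => /eqP; rewrite mulf_eq0 (negPf xk') => /eqP.
move: h2; rewrite !horner_arith qlx qrx !mulr0 subr0 addr0 -h1.
have Plx : Pl.[x] != 0.
  case: stl => _ cPQ _ _; have := coprimep_root cPQ; move/(_ x); rewrite -QlE Qlx.
  by rewrite eqxx => h; apply/negP => Px; have := h Px.
by move=> /(mulIf Plx).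
Qed.

(** * Uniqueness of a factorisation from interpolation data *)

Lemma size_le_coef0 (R : nzRingType) (p : {poly R}) (n : nat) :
  (size p <= n.+1)%N -> p`_n = 0 -> (size p <= n)%N.
Proof.
move=> sp pn; apply/leq_sizeP => j; rewrite leq_eqVlt => /orP[/eqP <- //|nj].
by rewrite nth_default // (leq_trans sp).
Qed.

Lemma poly_eq_nodes (R : idomainType) (N : nat) (x : 'I_N -> R) (p q : {poly R}) :
  injective x -> (size p <= N)%N -> (size q <= N)%N ->
  (forall i, p.[x i] = q.[x i]) -> p = q.
Proof.
move=> xinj sp sq pq; apply/eqP; rewrite -subr_eq0; apply/eqP.
apply: (@roots_geq_poly_eq0 _ _ [seq x i | i <- enum 'I_N]).
- by apply/allP => _ /mapP[i _ ->]; rewrite rootE hornerD hornerN pq subrr.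
- by rewrite map_inj_uniq ?enum_uniq.
by rewrite size_map size_enum_ord (leq_trans (size_polyD _ _)) // geq_max size_polyN sp.
Qed.

(** The top coefficient in Lagrange's interpolation formula. *)
Lemma lagrange_top (R : fieldType) (n : nat) (x : 'I_n.+1 -> R) (W H : {poly R}) :
  injective x -> size W = n.+2 -> (forall i, W.[x i] = 0) ->
  (forall i, W^`().[x i] != 0) -> (size H <= n.+1)%N ->
  H`_n = W`_n.+1 * \sum_i H.[x i] / W^`().[x i].
Proof.
move=> xinj sW Wx dW sH.
pose q i := W %/ ('X - (x i)%:P).
have qE i : W = q i * ('X - (x i)%:P).
  by rewrite divpK // dvdp_XsubCl rootE Wx.
have qi i : (q i).[x i] = W^`().[x i].
  by rewrite [in RHS](qE i) derivM derivXsubC mulr1 !hornerE subrr mulr0 add0r.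
have qj i j : j != i -> (q i).[x j] = 0.
  move=> ji; have := Wx j; rewrite (qE i) !hornerE => /eqP.
  by rewrite mulf_eq0 subr_eq0 (inj_eq xinj) (negPf ji) orbF => /eqP.
have q0 i : q i != 0 by apply: contra_neq (dW i); rewrite -qi => ->; rewrite horner0.
have sq i : size (q i) = n.+1.
  by apply: succn_inj; rewrite -sW [in RHS](qE i) mulrC size_monicM ?monicXsubC // size_XsubC.
have qn i : (q i)`_n = W`_n.+1.
  rewrite [in RHS](qE i) mulrBr coefB coefMX /= mulrC mul_polyC coefZ.
  by rewrite [(q i)`_n.+1]nth_default ?sq // mulr0 subr0.
have -> : H = \sum_i (H.[x i] / W^`().[x i]) *: q i.
  apply: (poly_eq_nodes xinj) => //.
    apply: (leq_trans (size_sum _ _ _)); apply/bigmax_leqP => i _.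
    by rewrite (leq_trans (size_scale_leq _ _)) ?sq.
  move=> j; rewrite horner_sum (bigD1 j) //= hornerZ qi divfK // big1 ?addr0 // => i ij.
  by rewrite hornerZ qj ?mulr0 // eq_sym.
rewrite coef_sum mulr_sumr; apply: eq_bigr => j _.
rewrite coefZ qn mulrC; congr (_ * (_ / _)).
rewrite horner_sum (bigD1 j) //= hornerZ qi divfK // big1 ?addr0 // => i ij.
by rewrite hornerZ qj ?mulr0 // eq_sym.
Qed.

(** Write R1 = r1 G and R2 = r2 G with G = gcd(R1, R2). Since R1 L1 and R2 L2 agree at 0
    and at the N = n + 1 nodes, they are the same polynomial A, and A = G r1 r2 E. The
    sums of p2 and x p2 kill the two top coefficients of A. If D = r1 r2 is not
    constant, then X G E has degree at most N - 2, so the sum of its values divided by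
    W' over the nodes vanishes. But G vanishes at the nodes where p2 does, and at the
    other ones the term is - x^2 p2 / D, where D is positive because R1 R2 = G^2 D. *)
Lemma factor_unique (R : rcfType) (n : nat) (x p2 : 'I_n.+1 -> R)
    (W R1 L1 R2 L2 : {poly R}) :
  injective x -> (forall i, x i != 0) ->
  size W = n.+2 -> W.[0] = 1 -> (forall i, W.[x i] = 0) ->
  (forall i, W^`().[x i] != 0) ->
  (forall i, 0 <= p2 i) -> \sum_i p2 i = 1 -> \sum_i x i * p2 i = 0 ->
  (size (R1 * L1)%R <= n.+2)%N -> (size (R2 * L2)%R <= n.+2)%N ->
  R1.[0] = 1 -> L1.[0] = 1 -> R2.[0] = 1 -> L2.[0] = 1 ->
  (forall i, (R1 * L1).[x i] = - (x i * p2 i * W^`().[x i])) ->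
  (forall i, (R2 * L2).[x i] = - (x i * p2 i * W^`().[x i])) ->
  (forall i, p2 i != 0 -> 0 < R1.[x i] * R2.[x i]) ->
  (forall i, p2 i = 0 -> R1.[x i] = 0 /\ R2.[x i] = 0) ->
  R1 = R2.
Proof.
move=> xinj x0 sW W0 Wx dW p20 sp sxp s1 s2 R10 L10 R20 L20 v1 v2 sgn zer.
have [A AD] : exists A, A = R1 * L1 by exists (R1 * L1).
rewrite -AD in s1 v1.
have A0 : A.[0] = 1 by rewrite AD hornerM R10 L10 mulr1.
have AE : A = R2 * L2.
  (* The nodes together with 0. *)
  pose y (i : 'I_n.+2) := if unlift ord0 i is Some j then x j else 0.
  have y0 : y ord0 = 0 by rewrite /y unlift_none.
  have yS j : y (lift ord0 j) = x j by rewrite /y liftK.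
  apply: (@poly_eq_nodes _ _ y) => //.
    move=> i j; case: (unliftP ord0 i) => [i'|] ->; case: (unliftP ord0 j) => [j'|] ->;
      rewrite ?y0 ?yS //.
    - by move=> /xinj ->.
    - by move=> h; have := x0 i'; rewrite h eqxx.
    - by move=> h; have := x0 j'; rewrite -h eqxx.
  move=> i; case: (unliftP ord0 i) => [i'|] ->; first by rewrite yS v1 v2.
  by rewrite y0 A0 hornerM R20 L20 mulr1.
(* Interpolation of (A - W) / X at the nodes. *)
have An1 : A`_n.+1 = 0.
  have /factor_theorem[H HE] : root (A - W) 0 by rewrite rootE !horner_arith A0 W0 subrr.
  rewrite subr0 in HE.
  have Hx i : H.[x i] / W^`().[x i] = - p2 i.
    have := congr1 (fun p : {poly R} => p.[x i]) HE.
    rewrite !horner_arith Wx subr0 v1 => h; apply: (mulIf (x0 i)).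
    by rewrite mulrAC -h; field; exact: dW.
  have Hn : H`_n = A`_n.+1 - W`_n.+1 by rewrite -coefB HE coefMX.
  have sH : (size H <= n.+1)%N.
    have [->|H0] := eqVneq H 0; first by rewrite size_poly0.
    rewrite -ltnS -(size_mulX H0) -HE (leq_trans (size_polyD _ _)) // geq_max.
    by rewrite size_polyN sW s1 /=.
  have := lagrange_top xinj sW Wx dW sH.
  under eq_bigr do rewrite Hx.
  by rewrite sumrN sp Hn mulrN1 => /eqP; rewrite subr_eq addNr => /eqP.
have sA1 : (size A <= n.+1)%N by exact: size_le_coef0.
have An : A`_n = 0.
  rewrite (lagrange_top xinj sW Wx dW sA1).
  rewrite (eq_bigr (fun i => - (x i * p2 i))); first by rewrite sumrN sxp oppr0 mulr0.
  by move=> i _; rewrite v1 mulNr mulfK.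
have sA : (size A <= n)%N by exact: size_le_coef0.
pose G := gcdp R1 R2; pose r1 := R1 %/ G; pose r2 := R2 %/ G.
have R1E : R1 = r1 * G by rewrite divpK // dvdp_gcdl.
have R2E : R2 = r2 * G by rewrite divpK // dvdp_gcdr.
have R1n0 : R1 != 0 by apply: contra_eq_neq R10 => ->; rewrite horner0 eq_sym oner_neq0.
have G0 : G != 0 by apply: contra_neq R1n0; rewrite R1E => ->; rewrite mulr0.
have cop : coprimep r1 r2 by rewrite coprimep_div_gcd // R1n0.
have [E L1E] : exists E, L1 = E * r2.
  apply/dvdpP; rewrite -(Gauss_dvdpr _ (_ : coprimep r2 r1)); last by rewrite coprimep_sym.
  have -> : r1 * L1 = r2 * L2; last exact: dvdp_mulIl.
  by apply: (mulIf G0); rewrite mulrAC -R1E [RHS]mulrAC -R2E -AE -AD.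
pose D := r1 * r2.
pose H := 'X * (G * E).
have HD : H * D = A * 'X by rewrite /H /D AD R1E L1E; ring.
have An0 : A != 0 by apply: contra_eq_neq A0 => ->; rewrite horner0 eq_sym oner_neq0.
have HDn0 : H * D != 0 by rewrite HD mulf_neq0 ?polyX_eq0.
move: (HDn0); rewrite mulf_eq0 negb_or => /andP[H0 D0].
have sHD : (size H + size D = (size A).+2)%N.
  have := size_mul H0 D0; rewrite HD size_mulX // => ->.
  by rewrite prednK // addn_gt0 size_poly_gt0 H0.
have [sD|sD] := leqP (size D) 1; last first.
  have sH : (size H <= n)%N.
    rewrite -(leq_add2r 2) (leq_trans (leq_add (leqnn _) sD)) // sHD addn2.
    by rewrite !ltnS.
  have := lagrange_top xinj sW Wx dW (leq_trans sH (leqnSn _)).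
  rewrite [H`_n]nth_default // => /esym/eqP.
  have Wn : W`_n.+1 != 0.
    by have := lead_coef_eq0 W; rewrite lead_coefE sW /= => ->; rewrite -size_poly_eq0 sW.
  rewrite mulf_eq0 (negPf Wn) /= -oppr_eq0 -sumrN.
  have Dx i : p2 i != 0 -> 0 < D.[x i].
    move=> /sgn h; rewrite R1E R2E !hornerM in h.
    have Gx : G.[x i] != 0 by apply: contraTneq h => ->; rewrite !mulr0 ltxx.
    have G2 : 0 < G.[x i] ^+ 2 by rewrite exprn_even_gt0.
    suff: 0 < G.[x i] ^+ 2 * D.[x i] by rewrite (pmulr_rgt0 _ G2).
    have -> // : G.[x i] ^+ 2 * D.[x i] = r1.[x i] * G.[x i] * (r2.[x i] * G.[x i]).
    by rewrite /D hornerM; ring.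
  have term i : - (H.[x i] / W^`().[x i]) =
      if p2 i == 0 then 0 else (x i) ^+ 2 * p2 i / D.[x i].
    have [z|nz] := eqVneq (p2 i) 0.
      have [z1 z2] := zer i z.
      have : root G (x i) by rewrite root_gcd !rootE z1 z2 eqxx.
      by rewrite rootE => /eqP Gx; rewrite /H !hornerM Gx mul0r mulr0 mul0r oppr0.
    have := congr1 (fun p : {poly R} => p.[x i]) HD.
    rewrite (hornerM H D) (hornerM A 'X) hornerX v1 => h.
    have d0 : D.[x i] != 0 by rewrite gt_eqF // Dx.
    rewrite -[H.[x i]](mulfK d0) h; field.
    by rewrite dW d0.
  rewrite psumr_eq0; last first.
    move=> i _; rewrite term; case: eqP => // /eqP nz.
    apply: divr_ge0; last exact: ltW (Dx _ nz).
    by apply: mulr_ge0; rewrite ?sqr_ge0 ?p20.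
  move=> /allP h.
  have : \sum_i p2 i == 0.
    apply/eqP; rewrite big1 // => i _; apply/eqP; apply/negPn/negP => nz.
    have := h i (mem_index_enum i); rewrite /= term (negPf nz).
    by rewrite !mulf_eq0 invr_eq0 (negPf nz) (negPf (x0 i)) /= gt_eqF // Dx.
  by rewrite sp oner_eq0.
have sD1 : size D = 1%N by apply/eqP; rewrite eqn_leq sD size_poly_gt0.
move: D0; rewrite /D mulf_eq0 negb_or => /andP[r10 r20].
have sr : (size r1 + size r2 = 2)%N.
  have := size_mul r10 r20; rewrite -/D sD1.
  by have := r10; rewrite -size_poly_gt0; case: (size r1) => // m _; rewrite addSn /= => <-.
have /size_poly1P[c1 c10 r1E] : size r1 == 1%N.
  move: sr r10 r20; rewrite -!size_poly_gt0.
  by case: (size r1) => [|[|m]] //; case: (size r2) => // m'; rewrite !addSn addnS.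
have /size_poly1P[c2 c20 r2E] : size r2 == 1%N.
  by move: sr; rewrite r1E size_polyC c10 add1n => -[->].
have : c1 * G.[0] = c2 * G.[0].
  have h1 := R10; have h2 := R20; rewrite R1E r1E in h1; rewrite R2E r2E in h2.
  by rewrite !horner_arith in h1 h2; rewrite h1 h2.
have G00 : G.[0] != 0.
  apply: contra_eq_neq R10; rewrite R1E hornerM => ->; rewrite mulr0 eq_sym oner_neq0 //.
by move=> /(mulIf G00) c12; rewrite R1E R2E r1E r2E c12.
Qed.

(** * The differential equation off the atoms *)

Local Open Scope classical_set_scope.
Local Open Scope complex_scope.

(** The general solution of h'' = h / 4. *)
Definition rexp (R : realType) (a b x : R) : R := a * expR (x / 2) + b * expR (- x / 2).

Lemma is_derive_rexp (R : realType) (a b x : R) :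
  is_derive x 1 (rexp a b) (rexp (a / 2) (- (b / 2)) x).
Proof.
have h c : is_derive x 1 (fun y : R => expR (c * y)) (c * expR (c * x)).
  have i := is_derive1_comp (is_derive_expR (c * x)) (is_deriveZ c (is_derive_id x 1)).
  by apply: (is_derive_eq i); rewrite mulrC /GRing.scale /= mulr1.
have i := is_deriveD (is_deriveZ a (h 2^-1)) (is_deriveZ b (h (- 2^-1))).
have e1 : rexp a b =
    (a \*: (fun y => expR (2^-1 * y)))%R + (b \*: (fun y => expR (- 2^-1 * y)))%R :> (R -> R).
  apply/funext => y; rewrite /rexp -[RHS]/(a * expR (2^-1 * y) + b * expR (- 2^-1 * y)).
  by congr (_ * expR _ + _ * expR _); field.
rewrite e1; apply: (is_derive_eq i); rewrite /GRing.scale /= /rexp.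
have -> : 2^-1 * x = x / 2 by field.
have -> : - 2^-1 * x = - x / 2 by field.
by field.
Qed.

Lemma derivable_rexp (R : realType) (a b x : R) : derivable (rexp a b) x 1.
Proof. by have [h _] := is_derive_rexp a b x. Qed.

Lemma rexp_cont (R : realType) (a b : R) : continuous (rexp a b).
Proof.
by move=> x; apply: differentiable_continuous; apply/derivable1_diffP; exact: derivable_rexp.
Qed.

Lemma derive0_const (R : realType) (h : R -> R) (x y : R) :
  x <= y -> (forall z, x <= z <= y -> is_derive z 1 h 0) -> h x = h y.
Proof.
move=> xy dh; have [| |c _] := @MVT_segment R h (cst 0) x y xy.
- by move=> z; rewrite in_itv /= => /andP[z1 z2]; apply: dh; rewrite !ltW.
- apply: derivable_within_continuous => z; rewrite in_itv /= => zxy.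
  by have [] := dh z zxy.
by rewrite mul0r => /eqP; rewrite subr_eq0 => /eqP.
Qed.

(** Both (h' + h / 2) e^(-x/2) and (h / 2 - h') e^(x/2) have derivative zero. *)
Lemma ode_rexp (R : realType) (J : set R) (h : R -> R) :
  (forall x y z, J x -> J y -> x <= z <= y -> J z) ->
  (forall x, J x -> [/\ derivable h x 1, derivable (derive1 h) x 1 &
     - derive1 (derive1 h) x + 4^-1 * h x = 0]) ->
  exists a b, forall x, J x -> h x = rexp a b x.
Proof.
move=> Jitv hode.
have [[x0 Jx0]|J0] := pselect (exists x, J x); last first.
  by exists 0, 0 => x Jx; case: J0; exists x.
have const (k : R -> R) : (forall x, J x -> is_derive x 1 k 0) -> forall x, J x -> k x = k x0.
  move=> dk x Jx; have [xx0|xx0] := leP x x0.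
    by apply: derive0_const => // z zx; apply: dk; exact: (Jitv _ _ _ Jx Jx0).
  apply/esym/derive0_const; first exact: ltW.
  by move=> z zx; apply: dk; exact: (Jitv _ _ _ Jx0 Jx).
pose g1 : R -> R := (derive1 h + (2^-1 \*: h)) * rexp 0 1.
pose g2 : R -> R := ((2^-1 \*: h) - derive1 h) * rexp 1 0.
have dh x : J x -> is_derive x 1 h ((derive1 h) x).
  by move=> /hode[h1 _ _]; rewrite derive1E; exact: derivableP.
have dh' x : J x -> is_derive x 1 (derive1 h) (4^-1 * h x).
  move=> /hode[_ h2 /eqP]; rewrite addrC subr_eq0 => /eqP ->.
  by rewrite derive1E; exact: derivableP.
have d1 x : J x -> is_derive x 1 g1 0.
  move=> Jx; have i1 := dh x Jx; have i2 := dh' x Jx.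
  apply: (is_derive_eq (is_deriveM (is_deriveD i2 (is_deriveZ 2^-1 i1)) (is_derive_rexp 0 1 x))).
  rewrite /GRing.scale /= -![(_ + _) x]/(derive1 h x + 2^-1 * h x) /rexp.
  by field.
have d2 x : J x -> is_derive x 1 g2 0.
  move=> Jx; have i1 := dh x Jx; have i2 := dh' x Jx.
  apply: (is_derive_eq (is_deriveM (is_deriveB (is_deriveZ 2^-1 i1) i2) (is_derive_rexp 1 0 x))).
  rewrite /GRing.scale /= -![(_ - _) x]/(2^-1 * h x - derive1 h x) /rexp.
  by field.
exists (g1 x0), (g2 x0) => x Jx.
rewrite -(const g1 d1 x Jx) -(const g2 d2 x Jx) /g1 /g2 {1}/rexp.
rewrite -[(_ * rexp 0 1) x]/((derive1 h x + 2^-1 * h x) * rexp 0 1 x).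
rewrite -[(_ * rexp 1 0) x]/((2^-1 * h x - derive1 h x) * rexp 1 0 x).
rewrite /rexp !mul0r !mul1r add0r addr0.
have e : expR (- x / 2) * expR (x / 2) = 1.
  by rewrite -expRD mulNr addNr expR0.
rewrite -mulrA e -mulrA [expR _ * expR _]mulrC e !mulr1; lra.
Qed.

Definition ceval (R : realType) (u : R[i] * R[i]) (x : R) : R[i] :=
  u.1 * (expR (x / 2))%:C + u.2 * (expR (- x / 2))%:C.

(** The coefficients of the derivative. *)
Definition dcoef (R : realType) (u : R[i] * R[i]) : R[i] * R[i] :=
  (u.1 / 2%:R%:C, - (u.2 / 2%:R%:C)).

Lemma rpart_ceval (R : realType) (u : R[i] * R[i]) :
  rpart (ceval u) = rexp (complex.Re u.1) (complex.Re u.2).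
Proof.
apply/funext => x; rewrite /rpart /ceval /rexp.
by case: u => -[a b] [c d] /=; rewrite !mulr0 !subr0.
Qed.

Lemma ipart_ceval (R : realType) (u : R[i] * R[i]) :
  ipart (ceval u) = rexp (complex.Im u.1) (complex.Im u.2).
Proof.
apply/funext => x; rewrite /ipart /ceval /rexp.
by case: u => -[a b] [c d] /=; rewrite !mulr0 !add0r.
Qed.

Lemma complex_divR (R : realType) (z : R[i]) (r : R) :
  z / r%:C = (complex.Re z / r) +i* (complex.Im z / r).
Proof.
case: z => a b; rewrite -fmorphV /=.
by apply/eqP; rewrite eq_complex /= !mulr0 subr0 add0r !eqxx.
Qed.

Lemma Re_dcoef (R : realType) (u : R[i] * R[i]) :
  rexp (complex.Re (dcoef u).1) (complex.Re (dcoef u).2)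
  = rexp (complex.Re u.1 / 2) (- (complex.Re u.2 / 2)).
Proof. by rewrite /dcoef !complex_divR. Qed.

Lemma Im_dcoef (R : realType) (u : R[i] * R[i]) :
  rexp (complex.Im (dcoef u).1) (complex.Im (dcoef u).2)
  = rexp (complex.Im u.1 / 2) (- (complex.Im u.2 / 2)).
Proof. by rewrite /dcoef !complex_divR. Qed.

Lemma near_ceval_derive (R : realType) (f : R -> R[i]) (u : R[i] * R[i]) (x : R) :
  (\forall y \near x, f y = ceval u y) ->
  cderivable f x /\ cderive f x = ceval (dcoef u) x.
Proof.
move=> fu.
have h1 : is_derive x 1 (rpart f) (rpart (ceval (dcoef u)) x).
  rewrite rpart_ceval Re_dcoef.
  apply: near_eq_is_derive (is_derive_rexp _ _ x).
  by near=> y; rewrite /rpart (near fu y) // -/(rpart (ceval u) y) rpart_ceval.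
have h2 : is_derive x 1 (ipart f) (ipart (ceval (dcoef u)) x).
  rewrite ipart_ceval Im_dcoef.
  apply: near_eq_is_derive (is_derive_rexp _ _ x).
  by near=> y; rewrite /ipart (near fu y) // -/(ipart (ceval u) y) ipart_ceval.
split; first by split; [have [] := h1 | have [] := h2].
apply/eqP; rewrite /cderive eq_complex /= !derive1E; apply/andP; split.
  by have [_ ->] := h1.
by have [_ ->] := h2.
Unshelve. all: by end_near. Qed.

Lemma ceval_ode (R : realType) (u : R[i] * R[i]) (x : R) :
  - ceval (dcoef (dcoef u)) x + 4^-1 * ceval u x = 0.
Proof.
have n2 : (2%:R%:C : R[i]) = 2 by rewrite rmorphMn.
by rewrite /ceval /dcoef /= n2; field.
Qed.

Lemma complex_quarter (R : realType) (z : R[i]) :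
  4^-1 * z = (4^-1 * complex.Re z) +i* (4^-1 * complex.Im z).
Proof.
have -> : (4^-1 : R[i]) = (4^-1)%:C by rewrite fmorphV rmorphMn.
by case: z => a b; apply/eqP; rewrite eq_complex /= !mul0r subr0 addr0 !eqxx.
Qed.

Lemma ode_ceval (R : realType) (J : set R) (f : R -> R[i]) :
  (forall x y z, J x -> J y -> x <= z <= y -> J z) ->
  (forall x, J x -> [/\ cderivable f x, cderivable (cderive f) x &
             - cderive (cderive f) x + 4^-1 * f x = 0]) ->
  exists u, forall x, J x -> f x = ceval u x.
Proof.
move=> Jitv fode.
have ReB (z w : R[i]) : - z + w = 0 -> - complex.Re z + complex.Re w = 0.
  by case: z w => [a b] [c d] /eqP; rewrite eq_complex => /andP[/eqP].
have ImB (z w : R[i]) : - z + w = 0 -> - complex.Im z + complex.Im w = 0.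
  by case: z w => [a b] [c d] /eqP; rewrite eq_complex => /andP[_ /eqP].
have [|a1 [b1 h1]] := @ode_rexp _ J (rpart f) Jitv.
  move=> x /fode[[d1 d2] [d3 d4] e]; split; [exact: d1|exact: d3|].
  by move: e; rewrite complex_quarter => /ReB.
have [|a2 [b2 h2]] := @ode_rexp _ J (ipart f) Jitv.
  move=> x /fode[[d1 d2] [d3 d4] e]; split; [exact: d2|exact: d4|].
  by move: e; rewrite complex_quarter => /ImB.
exists (a1 +i* a2, b1 +i* b2) => x Jx.
apply/eqP; rewrite eq_complex; apply/andP; split; apply/eqP.
  rewrite -[LHS]/(rpart f x) -[RHS]/(rpart (ceval (a1 +i* a2, b1 +i* b2)) x).
  by rewrite rpart_ceval /= h1.
rewrite -[LHS]/(ipart f x) -[RHS]/(ipart (ceval (a1 +i* a2, b1 +i* b2)) x).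
by rewrite ipart_ceval /= h2.
Qed.

Lemma ccvg_ceval (R : realType) (u : R[i] * R[i]) (F : set_system R) (x : R) :
  F `=>` nbhs x -> ccvg (ceval u) F (ceval u x).
Proof.
move=> Fx; rewrite /ccvg rpart_ceval ipart_ceval.
rewrite -[complex.Re (ceval u x)]/(rpart (ceval u) x) -[complex.Im (ceval u x)]/(ipart (ceval u) x).
rewrite rpart_ceval ipart_ceval.
by split=> A hA; apply: Fx; exact: (rexp_cont hA).
Qed.

Lemma ccvg_near (R : realType) (f g : R -> R[i]) (F : set_system R) {FF : Filter F}
    (l : R[i]) :
  (\forall y \near F, f y = g y) -> ccvg g F l -> ccvg f F l.
Proof.
move=> fg [h1 h2]; split.
  by apply: cvg_trans h1; apply: near_eq_cvg; near=> y; rewrite /rpart (near fg y).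
by apply: cvg_trans h2; apply: near_eq_cvg; near=> y; rewrite /ipart (near fg y).
Unshelve. all: by end_near. Qed.

Lemma ccvg_unique (R : realType) (f : R -> R[i]) (F : set_system R) {FF : ProperFilter F}
    (l l' : R[i]) :
  ccvg f F l -> ccvg f F l' -> l = l'.
Proof.
move=> [h1 h2] [h3 h4]; apply/eqP; rewrite eq_complex; apply/andP; split; apply/eqP.
  exact: (cvg_unique _ h1 h3).
exact: (cvg_unique _ h2 h4).
Qed.

Definition right_of (R : realType) (x : R) (mu : seq (R * R * R)) :=
  [seq A <- mu | x < loc A].
Definition from_of (R : realType) (x : R) (mu : seq (R * R * R)) :=
  [seq A <- mu | x <= loc A].

Lemma right_of_at_right (R : realType) (mu : seq (R * R * R)) (x : R) :
  \forall y \near at_right x, right_of y mu = right_of x mu.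
Proof.
elim: mu => [|A mu IH]; first by near=> y.
have [xA|Ax] := ltP x (loc A); near=> y;
  have e : right_of y mu = right_of x mu by [near: y].
  have yA : y < loc A by near: y; exact: nbhs_right_lt.
  by rewrite /right_of /= xA yA; congr cons.
have yA : loc A <= y by apply: (le_trans Ax); near: y; exact: nbhs_right_ge.
by rewrite /right_of /= !ltNge Ax yA.
Unshelve. all: by end_near. Qed.

Lemma right_of_at_left (R : realType) (mu : seq (R * R * R)) (x : R) :
  \forall y \near at_left x, right_of y mu = from_of x mu.
Proof.
elim: mu => [|A mu IH]; first by near=> y.
have [xA|Ax] := leP x (loc A); near=> y;
  have e : right_of y mu = from_of x mu by [near: y].
  have yA : y < loc A by apply: (lt_le_trans _ xA); near: y; exact: nbhs_left_lt.
  by rewrite /right_of /from_of /= xA yA; congr cons.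
have yA : loc A <= y by near: y; exact: nbhs_left_ge.
by rewrite /right_of /from_of /= ltNge yA leNgt Ax.
Unshelve. all: by end_near. Qed.

Lemma right_of_near (R : realType) (mu : seq (R * R * R)) (x : R) :
  x \notin [seq loc A | A <- mu] ->
  \forall y \near x, right_of y mu = right_of x mu /\ y \notin [seq loc A | A <- mu].
Proof.
elim: mu => [|A mu IH]; first by move=> _; near=> y.
rewrite /= inE negb_or => /andP[xA /IH{}IH].
case: (ltgtP x (loc A)) xA => // xA _; near=> y;
  have [e1 e2] : right_of y mu = right_of x mu /\ y \notin [seq loc A | A <- mu]
    by [near: y].
  rewrite /right_of /=; have yA : y < loc A by near: y; exact: lt_nbhsl.
  rewrite yA inE negb_or lt_eqF //; split=> //.
  by congr cons.
have yA : loc A < y by near: y; exact: lt_nbhsr.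
by rewrite ltNge (ltW yA) /= inE negb_or gt_eqF // e2.
Unshelve. all: by end_near. Qed.

Definition cweight (R : realType) (z : R[i]) (A : R * R * R) : R[i] :=
  z * (womega A)%:C + z ^+ 2 * (wv A)%:C.

Definition cstate (R : realType) (z : R[i]) (u0 : R[i] * R[i])
    (s : seq (R * R * R)) : R[i] * R[i] :=
  foldr (fun A u => jump (expR (loc A))%:C (expR (- loc A))%:C (cweight z A) u) u0 s.

Lemma expR_half (R : realType) (x : R) :
  [/\ expR x = expR (x / 2) ^+ 2, expR (- x) = expR (- x / 2) ^+ 2 &
      expR (x / 2) * expR (- x / 2) = 1].
Proof.
split; rewrite ?expr2 -expRD; first by rewrite -splitr.
  by rewrite -splitr.
by rewrite mulNr subrr expR0.
Qed.

Lemma ceval_jump (R : realType) (x : R) (h : R[i]) (u : R[i] * R[i]) :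
  let v := jump (expR x)%:C (expR (- x))%:C h u in
  ceval v x = ceval u x /\
  ceval (dcoef v) x = ceval (dcoef u) x + h * ceval u x.
Proof.
have [e1 e2 e3] := expR_half x.
rewrite /ceval /dcoef /jump /= e1 e2 !rmorphXn /=.
have n2 : (2%:R%:C : R[i]) = 2 by rewrite rmorphMn.
have e3c : (expR (x / 2))%:C * (expR (- x / 2))%:C = 1 :> R[i].
  by rewrite -rmorphM e3.
move: (expR (x / 2))%:C (expR (- x / 2))%:C e3c => E F EF.
rewrite n2; split; first by ring: EF.
rewrite [LHS](_ : _ = u.1 / 2 * E + - (u.2 / 2) * F + h * (u.1 * E + u.2 * F)
  + h / 2 * (E * F - 1) * (u.2 * F + u.1 * E)); last by field.
by rewrite EF subrr mulr0 mul0r addr0.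
Qed.

(** The jump conditions determine the coefficients on one side of the atom from those on
    the other one, since e^(x/2) and e^(-x/2) have nonvanishing Wronskian. *)
Lemma jump_unique (R : realType) (x : R) (h : R[i]) (u v : R[i] * R[i]) :
  ceval v x = ceval u x ->
  ceval (dcoef v) x = ceval (dcoef u) x + h * ceval u x ->
  v = jump (expR x)%:C (expR (- x))%:C h u.
Proof.
have [<- <-] := ceval_jump x h u.
move: (jump _ _ _ _) => [w1 w2]; case: v => v1 v2.
have [_ _ e3] := expR_half x.
rewrite /ceval /dcoef /=.
have n2 : (2%:R%:C : R[i]) = 2 by rewrite rmorphMn.
have e3c : (expR (x / 2))%:C * (expR (- x / 2))%:C = 1 :> R[i].
  by rewrite -rmorphM e3.
move: (expR (x / 2))%:C (expR (- x / 2))%:C e3c => E F EF.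
rewrite n2 => h1 h2.
have p1 : v1 * E = w1 * E.
  have -> : v1 * E = 2^-1 * (v1 * E + v2 * F) + (v1 / 2 * E + - (v2 / 2) * F) by field.
  by rewrite h1 h2; field.
have p2 : v2 * F = w2 * F.
  by apply: (addrI (v1 * E)); rewrite h1 p1.
congr pair.
  by rewrite -[v1]mulr1 -[w1]mulr1 -EF !mulrA p1.
by rewrite -[v2]mulr1 -[w2]mulr1 -EF [E * F]mulrC !mulrA p2.
Qed.

(** * The solutions of the equation *)

(** The solution with coefficients u0 near +oo. At an atom both adjacent formulas agree,
    so the choice of the strict inequality in [right_of] does not matter there. *)
Definition state_solution (R : realType) (z : R[i]) (u0 : R[i] * R[i])
    (mu : seq (R * R * R)) : R -> R[i] :=
  fun x => ceval (cstate z u0 (right_of x mu)) x.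

Lemma right_of_all (R : realType) (x : R) (s : seq (R * R * R)) :
  {in s, forall B, x < loc B} -> right_of x s = s.
Proof. by move=> h; apply/all_filterP/allP. Qed.

Lemma from_of_all (R : realType) (x : R) (s : seq (R * R * R)) :
  {in s, forall B, x < loc B} -> from_of x s = s.
Proof. by move=> h; apply/all_filterP/allP => B /h /ltW. Qed.

Lemma from_of_atom (R : realType) (mu : seq (R * R * R)) (A : R * R * R) :
  admissible mu -> A \in mu -> from_of (loc A) mu = A :: right_of (loc A) mu.
Proof.
elim: mu => // B s IH /admissible_cons[ad ltB _ _].
rewrite inE => /predU1P[->|sA].
  rewrite /from_of /right_of /= lexx ltxx; congr cons.
  by rewrite -/(from_of _ _) -/(right_of _ _) from_of_all // right_of_all.
have BA := ltB _ sA.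
rewrite /from_of /right_of /= (leNgt (loc A)) BA (ltNge (loc A) (loc B)) (ltW BA) /=.
exact: IH.
Qed.

Lemma from_of_nonatom (R : realType) (mu : seq (R * R * R)) (x : R) :
  x \notin [seq loc A | A <- mu] -> from_of x mu = right_of x mu.
Proof.
move=> xmu; apply: eq_in_filter => A muA; rewrite le_eqVlt.
by case: eqP => // e; move: xmu; rewrite e map_f.
Qed.

Lemma ceval_from_of (R : realType) (z : R[i]) (u0 : R[i] * R[i])
    (mu : seq (R * R * R)) (x : R) :
  admissible mu -> ceval (cstate z u0 (from_of x mu)) x = state_solution z u0 mu x.
Proof.
move=> ad; have [/mapP[A muA ->]|xmu] := boolP (x \in [seq loc A | A <- mu]); last first.
  by rewrite from_of_nonatom.
rewrite from_of_atom // /state_solution /=.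
by have [-> _] := ceval_jump (loc A) (cweight z A) (cstate z u0 (right_of (loc A) mu)).
Qed.

Lemma nonatom_near (R : realType) (mu : seq (R * R * R)) (x : R)
    (F : set_system R) {FF : Filter F} :
  F `=>` nbhs x -> (\forall y \near F, y != x) ->
  \forall y \near F, y \notin [seq loc A | A <- mu].
Proof.
move=> Fx Fn; elim: mu => [|A mu IH]; first by near=> y.
near=> y; rewrite /= inE negb_or; apply/andP; split; last by near: y.
near: y; have [<- //|xA] := eqVneq x (loc A).
apply: Fx; case: (ltgtP x (loc A)) xA => // xA _; near=> y.
  by rewrite lt_eqF //; near: y; exact: lt_nbhsl.
by rewrite gt_eqF //; near: y; exact: lt_nbhsr.
Unshelve. all: by end_near. Qed.

(** Near a point the list of atoms to the right is constant on each side, hence so are the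
    coefficients, and [ceval_jump] gives the conditions at the atoms. *)
Lemma state_solutionP (R : realType) (z : R[i]) (u0 : R[i] * R[i]) (mu : seq (R * R * R)) :
  admissible mu -> solution mu z (state_solution z u0 mu).
Proof.
move=> ad; set f := state_solution z u0 mu.
have fr x : \forall y \near at_right x, f y = ceval (cstate z u0 (right_of x mu)) y.
  by near=> y; rewrite /f /state_solution (near (right_of_at_right mu x) y).
have fl x : \forall y \near at_left x, f y = ceval (cstate z u0 (from_of x mu)) y.
  by near=> y; rewrite /f /state_solution (near (right_of_at_left mu x) y).
have atr (x : R) : at_right x `=>` nbhs x by move=> A hA; apply: filterS hA => y Ay _.
have atl (x : R) : at_left x `=>` nbhs x by move=> A hA; apply: filterS hA => y Ay _.
have cr x : ccvg f (at_right x) (f x).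
  by apply: ccvg_near (fr x) _; exact: ccvg_ceval (atr x).
have cl x : ccvg f (at_left x) (f x).
  apply: ccvg_near (fl x) _; rewrite /f -(ceval_from_of z u0 x ad).
  exact: ccvg_ceval (atl x).
have fn x : x \notin [seq loc A | A <- mu] ->
    \forall y \near x, f y = ceval (cstate z u0 (right_of x mu)) y
      /\ y \notin [seq loc A | A <- mu].
  move=> xmu; near=> y.
  have [e1 e2] : right_of y mu = right_of x mu /\ y \notin [seq loc A | A <- mu].
    by near: y; exact: right_of_near.
  by rewrite /f /state_solution e1.
have fd x : x \notin [seq loc A | A <- mu] ->
    cderivable f x /\ cderive f x = ceval (dcoef (cstate z u0 (right_of x mu))) x.
  move=> xmu; apply: near_ceval_derive; near=> y.
  by have [] := near (fn x xmu) y.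
split.
- split=> x; apply/left_right_continuousP.
    by split; [have [] := cl x|have [] := cr x].
  by split; [have [] := cl x|have [] := cr x].
- move=> x xmu; have [d1 e1] := fd x xmu.
  have d2 : \forall y \near x, cderive f y = ceval (dcoef (cstate z u0 (right_of x mu))) y.
    near=> y.
    have [e2 e3] : right_of y mu = right_of x mu /\ y \notin [seq loc A | A <- mu].
      by near: y; exact: right_of_near.
    by have [_ ->] := fd y e3; rewrite e2.
  have [d3 ->] := near_ceval_derive d2.
  by split=> //; exact: ceval_ode.
move=> A muA; set a := loc A.
have cd (F : set_system R) (s : seq (R * R * R)) : Filter F -> F `=>` nbhs a ->
    (\forall y \near F, y != a) -> (\forall y \near F, right_of y mu = s) ->
    ccvg (cderive f) F (ceval (dcoef (cstate z u0 s)) a).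
  move=> FF Fa Fn Fs; apply: ccvg_near (ccvg_ceval _ Fa); near=> y.
  have ny : y \notin [seq loc A | A <- mu] by near: y; exact: nonatom_near Fn.
  by have [_ ->] := fd y ny; rewrite (near Fs y).
exists (ceval (dcoef (cstate z u0 (from_of a mu))) a),
  (ceval (dcoef (cstate z u0 (right_of a mu))) a).
split.
- by apply: cd; [exact: atl|exact: nbhs_left_neq|exact: right_of_at_left].
- by apply: cd; [exact: atr|exact: nbhs_right_neq|exact: right_of_at_right].
rewrite from_of_atom //=.
have [_ ->] := ceval_jump a (cweight z A) (cstate z u0 (right_of a mu)).
by rewrite /cweight mulrDl addrA.
Unshelve. all: by end_near. Qed.

(** For a splitting of the atoms into p followed by s, the open interval between them. *)
Definition gap (R : realType) (p s : seq (R * R * R)) : set R :=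
  [set y | {in p, forall B, loc B < y} /\ {in s, forall B, y < loc B}].

Lemma near_all (R : realType) (F : set_system R) {FF : Filter F}
    (s : seq (R * R * R)) (P : R * R * R -> R -> Prop) :
  {in s, forall B, \forall y \near F, P B y} ->
  \forall y \near F, {in s, forall B, P B y}.
Proof.
elim: s => [|A s IH] h; first by near=> y.
have h1 : \forall y \near F, P A y by apply: h; rewrite mem_head.
have h2 : \forall y \near F, {in s, forall B, P B y}.
  by apply: IH => B sB; apply: h; rewrite inE sB orbT.
near=> y => B; rewrite inE => /predU1P[->|]; first by near: y.
by move: B; near: y.
Unshelve. all: by end_near. Qed.

Lemma gap_open (R : realType) (p s : seq (R * R * R)) (x : R) :
  gap p s x -> \forall y \near x, gap p s y.
Proof.
move=> [px xs]; near=> y; split; near: y; apply: near_all => B hB.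
  exact: lt_nbhsr (px B hB).
exact: lt_nbhsl (xs B hB).
Unshelve. all: by end_near. Qed.

Lemma gap_at_left (R : realType) (p s : seq (R * R * R)) (a : R) :
  {in p, forall B, loc B < a} -> {in s, forall B, a <= loc B} ->
  \forall y \near at_left a, gap p s y.
Proof.
move=> pa sa; near=> y; split; near: y; apply: near_all => B hB.
  exact: nbhs_left_gt (pa B hB).
by apply: filterS (nbhs_left_lt a) => y ya; exact: lt_le_trans ya (sa B hB).
Unshelve. all: by end_near. Qed.

Lemma gap_at_right (R : realType) (p s : seq (R * R * R)) (a : R) :
  {in p, forall B, loc B <= a} -> {in s, forall B, a < loc B} ->
  \forall y \near at_right a, gap p s y.
Proof.
move=> pa sa; near=> y; split; near: y; apply: near_all => B hB.
  by apply: filterS (nbhs_right_gt a) => y ya; exact: le_lt_trans (pa B hB) ya.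
exact: nbhs_right_lt (sa B hB).
Unshelve. all: by end_near. Qed.

Lemma gap_nonatom (R : realType) (p s : seq (R * R * R)) (x : R) :
  gap p s x -> x \notin [seq loc A | A <- p ++ s].
Proof.
move=> [px xs]; apply/mapP => -[A]; rewrite mem_cat => /orP[/px|/xs] + e.
  by rewrite e ltxx.
by rewrite e ltxx.
Qed.

Lemma gap_solution (R : realType) (z : R[i]) (p s : seq (R * R * R)) (f : R -> R[i]) :
  solution (p ++ s) z f -> exists u, forall y, gap p s y -> f y = ceval u y.
Proof.
move=> [_ ode _]; apply: ode_ceval => [x y t [px xs] [py ys] /andP[xt ty]|x gx].
  split=> B hB; first exact: lt_le_trans (px B hB) xt.
  exact: le_lt_trans ty (ys B hB).
by apply: ode; exact: gap_nonatom.
Qed.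

Lemma solution_jump (R : realType) (z : R[i]) (p s : seq (R * R * R)) (A : R * R * R)
    (f : R -> R[i]) (u v : R[i] * R[i]) :
  admissible (p ++ A :: s) -> solution (p ++ A :: s) z f ->
  (forall y, gap p (A :: s) y -> f y = ceval u y) ->
  (forall y, gap (rcons p A) s y -> f y = ceval v y) ->
  u = jump (expR (loc A))%:C (expR (- loc A))%:C (cweight z A) v
  /\ f (loc A) = ceval v (loc A).
Proof.
move=> /admissible_cat[_ /admissible_cons[_ ltA _ _] ltp] [[cf1 cf2] _ jmp] fu fv.
set a := loc A.
have pa : {in p, forall B, loc B < a} by move=> B pB; apply: ltp => //; rewrite mem_head.
have gl : \forall y \near at_left a, gap p (A :: s) y.
  apply: gap_at_left => // B; rewrite inE => /predU1P[->|/ltA/ltW] //.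
have gr : \forall y \near at_right a, gap (rcons p A) s y.
  apply: gap_at_right => // B; rewrite mem_rcons inE => /predU1P[-> //|/pa/ltW //].
have atr : at_right a `=>` nbhs a by move=> E horner_arith; apply: filterS horner_arith => y Ey _.
have atl : at_left a `=>` nbhs a by move=> E horner_arith; apply: filterS horner_arith => y Ey _.
have cfl : ccvg f (at_left a) (f a).
  by split; move=> E horner_arith; apply: atl; [exact: cf1|exact: cf2].
have cfr : ccvg f (at_right a) (f a).
  by split; move=> E horner_arith; apply: atr; [exact: cf1|exact: cf2].
have fau : f a = ceval u a.
  apply: (ccvg_unique cfl); apply: ccvg_near (ccvg_ceval u atl).
  by near=> y; apply: fu; near: y.
have fav : f a = ceval v a.
  apply: (ccvg_unique cfr); apply: ccvg_near (ccvg_ceval v atr).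
  by near=> y; apply: fv; near: y.
have du y : gap p (A :: s) y -> cderive f y = ceval (dcoef u) y.
  move=> gy; have [] // := @near_ceval_derive _ f u y.
  by near=> t; apply: fu; near: t; exact: gap_open.
have dv y : gap (rcons p A) s y -> cderive f y = ceval (dcoef v) y.
  move=> gy; have [] // := @near_ceval_derive _ f v y.
  by near=> t; apply: fv; near: t; exact: gap_open.
have [|dl [dr [hl hr e]]] := jmp A; first by rewrite mem_cat mem_head orbT.
have dlE : dl = ceval (dcoef u) a.
  apply: (ccvg_unique hl); apply: ccvg_near (ccvg_ceval _ atl).
  by near=> y; apply: du; near: y.
have drE : dr = ceval (dcoef v) a.
  apply: (ccvg_unique hr); apply: ccvg_near (ccvg_ceval _ atr).
  by near=> y; apply: dv; near: y.
split=> //; apply: jump_unique; first by rewrite -fau fav.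
by rewrite -dlE e -drE -fav -/a /cweight mulrDl addrA.
Unshelve. all: by end_near. Qed.

(** By induction over the atoms from right to left: on each gap the equation gives some
    coefficients, and the conditions at the atom tie them to those of the previous
    gap. *)
Lemma solution_state (R : realType) (z : R[i]) (mu : seq (R * R * R)) (f : R -> R[i]) :
  admissible mu -> solution mu z f -> exists u0, f = state_solution z u0 mu.
Proof.
move=> ad sol.
have [u0 hu0] : exists u0, forall y, gap mu [::] y -> f y = ceval u0 y.
  by apply: gap_solution; rewrite cats0; exact: sol.
exists u0.
have key s p : mu = p ++ s -> 
    (forall y, gap p s y -> f y = ceval (cstate z u0 s) y) /\
    {in s, forall A, f (loc A) = state_solution z u0 mu (loc A)}.
  elim: s p => [|A s IH] p muE.
    by rewrite cats0 in muE; rewrite -muE; split.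
  have [h1 h2] := IH (rcons p A) (etrans muE (esym (cat_rcons _ _ _))).
  have sol' := sol; rewrite muE in sol'.
  have ad' := ad; rewrite muE in ad'.
  have [u hu] := gap_solution sol'.
  have [uE fA] := solution_jump ad' sol' hu h1.
  split; first by move=> y gy; rewrite hu // uE.
  move=> B; rewrite inE => /predU1P[->|]; last exact: h2.
  rewrite fA /state_solution; congr (ceval (cstate _ _ _) _).
  have /admissible_cat[_ /admissible_cons[_ ltA _ _] ltp] := ad'.
  rewrite muE /right_of filter_cat /= ltxx -/(right_of _ s) right_of_all //.
  rewrite (@eq_in_filter _ _ pred0) ?filter_pred0 // => B' pB /=.
  by apply/negbTE; rewrite -leNgt ltW // ltp // mem_head.
apply/funext => x.
have [/mapP[A muA ->]|xmu] := boolP (x \in [seq loc A | A <- mu]).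
  by have [_ h] := key mu [::] erefl; exact: h.
have spl p s : mu = p ++ s -> gap p s x -> f x = state_solution z u0 mu x.
  move=> muE gx; have [h _] := key s p muE; rewrite h // /state_solution.
  congr (ceval (cstate _ _ _) _); rewrite muE /right_of filter_cat.
  have [px xs] := gx; rewrite -/(right_of _ s) right_of_all //.
  rewrite (@eq_in_filter _ _ pred0) ?filter_pred0 // => B' pB /=.
  by apply/negbTE; rewrite -leNgt ltW // px.
have {}spl : (exists p s, mu = p ++ s /\ gap p s x) -> f x = state_solution z u0 mu x.
  by move=> [p [s [h1 h2]]]; exact: spl h1 h2.
apply: spl; move: xmu ad; clear.
elim: mu => [|A mu IH]; first by exists [::], [::]; split=> //; split.
rewrite /= inE negb_or => /andP[xA /IH{}IH] /admissible_cons[/IH[p [s [-> [h1 h2]]]] ltA _ _].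
case: (ltgtP x (loc A)) xA => // xA _.
  exists [::], (A :: p ++ s); split=> //; split=> // B; rewrite inE => /predU1P[-> //|/ltA].
  exact: lt_trans.
by exists (A :: p), s; split=> //; split=> // B; rewrite inE => /predU1P[-> //|/h1].
Qed.

Lemma gap_pinfty (R : realType) (mu : seq (R * R * R)) :
  \forall y \near +oo, gap mu [::] y.
Proof.
near=> y; split=> //; near: y; apply: near_all => B _.
by apply: nbhs_pinfty_gt; exact: num_real.
Unshelve. all: by end_near. Qed.

Lemma gap_ninfty (R : realType) (mu : seq (R * R * R)) :
  \forall y \near -oo, gap [::] mu y.
Proof.
near=> y; split=> //; near: y; apply: near_all => B _.
by apply: nbhs_ninfty_lt; exact: num_real.
Unshelve. all: by end_near. Qed.

Lemma right_of_gap_nil (R : realType) (mu : seq (R * R * R)) (x : R) :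
  gap mu [::] x -> right_of x mu = [::].
Proof.
move=> [h _]; rewrite /right_of (@eq_in_filter _ _ pred0) ?filter_pred0 // => B /h /= hB.
by apply/negbTE; rewrite -leNgt ltW.
Qed.

Lemma ceval_inj (R : realType) (u v : R[i] * R[i]) (x : R) :
  (\forall y \near x, ceval u y = ceval v y) -> u = v.
Proof.
move=> uv.
have [_ h1] := near_ceval_derive uv.
have uu : \forall y \near x, ceval u y = ceval u y by near=> y.
have [_ h2] := near_ceval_derive uu.
have e := nbhs_singleton uv.
rewrite (@jump_unique _ x 0 v u) //; last by rewrite mul0r addr0 -h1 -h2.
by case: (v) => a b; rewrite /jump /= !mul0r addr0 subr0.
Unshelve. all: by end_near. Qed.

Lemma ceval_inj_pinfty (R : realType) (u v : R[i] * R[i]) :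
  (\forall y \near +oo, ceval u y = ceval v y) -> u = v.
Proof.
move=> [M [_ h]]; apply: (@ceval_inj _ _ _ (M + 1)).
near=> y; apply: h; near: y; apply: lt_nbhsr; by rewrite ltrDl.
Unshelve. all: by end_near. Qed.

Lemma ceval_phi (R : realType) (x : R) : ceval (0, 1) x = (expR (- x / 2))%:C.
Proof. by rewrite /ceval mul0r mul1r add0r. Qed.

Lemma phi_plusE (R : realType) (mu : seq (R * R * R)) (z : R[i]) :
  admissible mu -> phi_plus mu z = state_solution z (0, 1) mu.
Proof.
move=> ad; rewrite /phi_plus; apply: xget_unique.
  split; first exact: state_solutionP.
  near=> x; rewrite /state_solution right_of_gap_nil ?ceval_phi //.
  by near: x; exact: gap_pinfty.
move=> f [/(solution_state ad)[u0 ->] h]; congr (state_solution _ _ _).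
apply: ceval_inj_pinfty; near=> y.
rewrite ceval_phi -(near h y) // /state_solution right_of_gap_nil //.
by near: y; exact: gap_pinfty.
Unshelve. all: by end_near. Qed.

(** * Eigenvalues and norming constants *)

Lemma normc_real (R : realType) (x : R) : normc x%:C = `|x|.
Proof. by rewrite /normc /= expr0n /= addr0 sqrtr_sqr. Qed.

Lemma normc_triangle (R : realType) (x y : R[i]) : normc (x + y) <= normc x + normc y.
Proof. exact: (le_normcD (x : Rcomplex R) y). Qed.

Lemma normc_opp (R : realType) (x : R[i]) : normc (- x) = normc x.
Proof. exact: (normcN (x : Rcomplex R)). Qed.

Lemma normc_nonneg (R : realType) (x : R[i]) : 0 <= normc x.
Proof. by case: x => a b; exact: sqrtr_ge0. Qed.

Lemma cstate_map (R : realType) (z : R[i]) (s : seq (R * R * R)) :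
  cstate z (0, 1) s = ((map_poly (real_complex R) (pstate s).1).[z],
                       (map_poly (real_complex R) (pstate s).2).[z]).
Proof.
elim: s => [|A s IH] /=; first by rewrite rmorph0 rmorph1 !hornerE.
rewrite IH /jump /=.
have hw : (map_poly (real_complex R) (hpoly A)).[z] = cweight z A.
  rewrite /hpoly /cweight !rmorphD !rmorphM /= !map_polyC !map_polyX /=.
  rewrite !(hornerD, hornerM, hornerX, hornerC); ring.
move: (hpoly A) (cweight z A) hw => p w hw.
rewrite !rmorphD !rmorphN !rmorphM /= !rmorphD !rmorphM /= !map_polyC /=.
by rewrite !(hornerD, hornerN, hornerM) hw !hornerC.
Qed.

Lemma cstate_scale (R : realType) (z c : R[i]) (u : R[i] * R[i]) (s : seq (R * R * R)) :
  cstate z (c * u.1, c * u.2) s = (c * (cstate z u s).1, c * (cstate z u s).2).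
Proof.
elim: s => [//|A s IH] /=; rewrite IH /jump /=; congr pair; ring.
Qed.

Lemma cstate_real (R : realType) (x : R) (s : seq (R * R * R)) :
  cstate x%:C (0, 1) s = (((pstate s).1.[x])%:C, ((pstate s).2.[x])%:C).
Proof. by rewrite cstate_map !horner_map. Qed.

Lemma normc_expR (R : realType) (c : R[i]) (x : R) :
  normc (c * (expR x)%:C) = normc c * expR x.
Proof. by rewrite normcM normc_real ger0_norm // expR_ge0. Qed.

(** A nonzero coefficient of e^(x/2) makes the solution unbounded, since e^(x/2) >= 1 +
    x/2. *)
Lemma bounded_pinfty (R : realType) (u : R[i] * R[i]) (M m : R) :
  (forall x, m < x -> normc (ceval u x) <= M) -> u.1 = 0.
Proof.
move=> h; apply/eqP/negPn/negP => u10.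
have c0 : 0 < normc u.1.
  by rewrite lt_def normc_nonneg andbT; apply: contra_neq u10 => /eq0_normc.
pose K := M + normc u.2 * expR (- m / 2).
have hK x : m < x -> normc u.1 * expR (x / 2) <= K.
  move=> mx; rewrite -normc_expR.
  have -> : u.1 * (expR (x / 2))%:C = ceval u x + - (u.2 * (expR (- x / 2))%:C).
    by rewrite /ceval addrK.
  apply: (le_trans (normc_triangle _ _)); rewrite normc_opp normc_expR.
  apply: lerD; first exact: h.
  apply: ler_wpM2l; first exact: normc_nonneg.
  by rewrite ler_expR; lra.
(* At this point 1 + x / 2 exceeds K / |u.1|. *)
pose x := Num.max (m + 1) (2 * (K / normc u.1)).
have mx : m < x by rewrite lt_max ltrDl ltr01.
have xK : 2 * (K / normc u.1) <= x by rewrite le_max lexx orbT.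
have := hK x mx; rewrite leNgt => /negP; apply.
rewrite mulrC -ltr_pdivrMr //.
have : 1 + x / 2 <= expR (x / 2) by exact: expR_ge1Dx.
by apply: lt_le_trans; lra.
Qed.

Lemma ceval_swap (R : realType) (u : R[i] * R[i]) (x : R) :
  ceval (u.2, u.1) x = ceval u (- x).
Proof. by rewrite /ceval opprK addrC. Qed.

Lemma bounded_ninfty (R : realType) (u : R[i] * R[i]) (M m : R) :
  (forall x, x < m -> normc (ceval u x) <= M) -> u.2 = 0.
Proof.
move=> h; apply: (@bounded_pinfty _ (u.2, u.1) M (- m)) => x mx.
by rewrite ceval_swap; apply: h; rewrite ltrNl.
Qed.

Lemma normc_bounded_itv (R : realType) (f : R -> R[i]) (a b : R) :
  a <= b -> ccontinuous f -> exists M, forall x, a <= x <= b -> normc (f x) <= M.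
Proof.
move=> ab [c1 c2].
pose g x := rpart f x * rpart f x + ipart f x * ipart f x.
have cg : continuous g.
  move=> x; apply: cvgD; apply: cvgM; by [exact: c1|exact: c2].
have [|c _ hc] := @EVT_max R g a b ab; first exact: continuous_subspaceT.
exists (Num.sqrt (g c)) => x xab.
have := hc x; rewrite in_itv => /(_ xab); rewrite /g /rpart /ipart.
by case: (f x) => p q /=; rewrite -!expr2 => hx; rewrite ler_wsqrtr.
Qed.

(** Boundedness at +oo leaves only multiples of the solution which is e^(-x/2) there, and
    this one is bounded at -oo if and only if its coefficient of e^(-x/2) vanishes. *)
Lemma eigenvalueP (R : realType) (mu : seq (R * R * R)) (z : R[i]) :
  admissible mu ->
  Defs.eigenvalue mu z <-> (map_poly (real_complex R) (pstate mu).2).[z] = 0.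
Proof.
move=> ad; have [M [_ hM]] := gap_pinfty mu; have [m [_ hm]] := gap_ninfty mu.
have fp u0 x : M < x -> state_solution z u0 mu x = ceval u0 x.
  by move=> /hM gx; rewrite /state_solution right_of_gap_nil.
have fm u0 x : x < m -> state_solution z u0 mu x = ceval (cstate z u0 mu) x.
  by move=> /hm[_ gx]; rewrite /state_solution right_of_all.
split.
  move=> [f [/(solution_state ad)[u0 ->] [x0 fx0] [B hB]]].
  have u01 : u0.1 = 0.
    by apply: (@bounded_pinfty _ _ B M) => x Mx; rewrite -fp.
  have : (cstate z u0 mu).2 = 0.
    by apply: (@bounded_ninfty _ _ B m) => x xm; rewrite -fm.
  have u0E : u0 = (u0.2 * 0, u0.2 * 1) by rewrite mulr0 mulr1 -u01; case: (u0).
  rewrite u0E (@cstate_scale _ _ _ (0, 1)) /= cstate_map /= => /eqP.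
  rewrite mulf_eq0 => /orP[/eqP u02|/eqP //].
  move: fx0; rewrite /state_solution u0E u02 mul0r.
  have := @cstate_scale _ z 0 (0, 0) (right_of x0 mu); rewrite /= !mul0r => ->.
  by rewrite /ceval !mul0r addr0 eqxx.
move=> Wz; exists (state_solution z (0, 1) mu); split.
- exact: state_solutionP.
- exists (M + 1); rewrite fp ?ltrDl // ceval_phi.
  by apply/eqP => /eqP; rewrite eq_complex /= gt_eqF // expR_gt0.
have [cont _ _] := state_solutionP z (0, 1) ad.
pose a := Num.min m M - 1; pose b := Num.max m M + 1.
have am : a < m.
  have : Num.min m M <= m by rewrite ge_min lexx.
  rewrite /a; lra.
have Mb : M < b.
  have : M <= Num.max m M by rewrite le_max lexx orbT.
  rewrite /b; lra.
have ab : a <= b.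
  have : Num.min m M <= Num.max m M by rewrite ge_min le_max lexx.
  rewrite /a /b; lra.
have [K hK] := normc_bounded_itv ab cont.
exists (Num.max K (Num.max (normc (cstate z (0, 1) mu).1 * expR (m / 2)) (expR (- M / 2)))) => x.
have [xa|ax] := ltP x a.
  rewrite fm ?(lt_trans xa) // /ceval cstate_map /= Wz mul0r addr0 normc_expR.
  rewrite !le_max; apply/orP; right; apply/orP; left.
  apply: ler_wpM2l; first exact: normc_nonneg.
  by rewrite ler_expR; lra.
have [bx|xb] := ltP b x.
  rewrite fp ?(lt_trans Mb) // ceval_phi normc_real ger0_norm ?expR_ge0 //.
  rewrite !le_max; apply/orP; right; apply/orP; right.
  by rewrite ler_expR; lra.
by rewrite le_max hK // ax xb.
Qed.

Lemma phi_plus_real (R : realType) (mu : seq (R * R * R)) (k x : R) :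
  admissible mu ->
  phi_plus mu k%:C x = (expR (- x / 2) * (Qright x (right_of x mu)).[k])%:C.
Proof.
move=> ad; rewrite phi_plusE // /state_solution cstate_real /ceval /=.
rewrite -!rmorphM -rmorphD; congr (_%:C).
have [e1 _ e3] := expR_half x.
rewrite /Qright !horner_arith e1.
move: (expR (x / 2)) (expR (- x / 2)) e3 => E F EF.
by ring: EF.
Qed.

Lemma gamma2E (R : realType) (mu : seq (R * R * R)) (k : R) :
  admissible mu -> gamma2 mu k = (norm_sum mu).[k].
Proof.
move=> ad; rewrite /gamma2 /int_omega /int_v mulr_sumr -big_split /=.
transitivity (\sum_(A <- mu) (womega A + 2 * k * wv A) * (expR (- loc A)
    * (Qright (loc A) (right_of (loc A) mu)).[k] ^+ 2)).
  apply: eq_bigr => A _; rewrite phi_plus_real // normc_real real_normK ?num_real //.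
  have [_ -> _] := expR_half (loc A); rewrite exprMn; ring.
elim: mu ad => [|A s IH] ad /=; first by rewrite big_nil horner0.
have /admissible_cons[ads ltA _ _] := ad.
rewrite big_cons [RHS]hornerD -(IH ads); congr (_ + _).
  rewrite /= ltxx right_of_all // /hpoly !(hornerM, horner_exp) hornerC.
  rewrite !(derivD, derivM, derivC, derivX, derivXn) -/(Qright _ _) !horner_arith.
  by rewrite !hornerE /=; ring.
rewrite big_seq [RHS]big_seq; apply: eq_bigr => B sB.
by rewrite /right_of /= ltNge (ltW (ltA _ sB)).
Qed.

(** At an eigenvalue the second coefficient vanishes, so that only one term of the
    Lagrange identity remains. *)
Lemma gamma2_coupling (R : realType) (mu : seq (R * R * R)) (k : R) :
  admissible mu -> (pstate mu).2.[k] = 0 -> k * gamma2 mu k = coupling mu k.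
Proof.
move=> ad Wk; rewrite gamma2E // pstate_lagrange /coupling.
by rewrite !horner_arith Wk mulr0 add0r mulrN mulrA.
Qed.

(** * The spectral data compatible with given interior data *)

Definition left_of (R : realType) (x : R) (mu : seq (R * R * R)) :=
  [seq A <- mu | loc A < x].
Definition atoms_at (R : realType) (x : R) (mu : seq (R * R * R)) :=
  [seq A <- mu | loc A == x].

Lemma is_pairE (R : realType) (mu : seq (R * R * R)) :
  is_pair mu <-> (0 < size mu)%N /\ admissible mu.
Proof. by split=> [[h1 h2 h3 h4]|[h1 [h2 h3 h4]]]; split. Qed.

Lemma split_at (R : realType) (a : R) (mu : seq (R * R * R)) :
  admissible mu -> mu = left_of a mu ++ atoms_at a mu ++ right_of a mu.
Proof.
elim: mu => [//|A s IH] /admissible_cons[/IH{}IH ltA _ _].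
rewrite /left_of /atoms_at /right_of /=.
case: (ltgtP (loc A) a) => aA /=; first by rewrite {1}IH.
  have e B : B \in s -> a < loc B by move=> /ltA; exact: lt_trans.
  rewrite (@eq_in_filter _ _ pred0) ?filter_pred0; last first.
    by move=> B /e h /=; apply/negbTE; rewrite -leNgt ltW.
  rewrite (@eq_in_filter _ _ pred0) ?filter_pred0; last first.
    by move=> B /e h /=; rewrite gt_eqF.
  by congr cons; symmetry; apply/all_filterP/allP.
have e B : B \in s -> a < loc B by move=> /ltA; rewrite aA.
rewrite (@eq_in_filter _ _ pred0) ?filter_pred0; last first.
  by move=> B /e h /=; apply/negbTE; rewrite -leNgt ltW.
rewrite (@eq_in_filter _ (fun B => loc B == a) pred0) ?filter_pred0; last first.
  by move=> B /e h /=; rewrite gt_eqF.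
by congr cons; symmetry; apply/all_filterP/allP.
Qed.

Lemma left_ofP (R : realType) (a : R) (mu : seq (R * R * R)) :
  {in left_of a mu, forall A, loc A < a}.
Proof. by move=> A; rewrite mem_filter => /andP[]. Qed.

Lemma right_ofP (R : realType) (a : R) (mu : seq (R * R * R)) :
  {in right_of a mu, forall A, a < loc A}.
Proof. by move=> A; rewrite mem_filter => /andP[]. Qed.

Lemma atoms_atP (R : realType) (a : R) (mu : seq (R * R * R)) :
  {in atoms_at a mu, forall A, loc A = a}.
Proof. by move=> A; rewrite mem_filter => /andP[/eqP]. Qed.

Lemma right_of_split (R : realType) (a : R) (s1 c s2 : seq (R * R * R)) :
  {in s1, forall A, loc A < a} -> {in c, forall A, loc A = a} ->
  {in s2, forall A, a < loc A} -> right_of a (s1 ++ c ++ s2) = s2.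
Proof.
move=> h1 h2 h3; rewrite /right_of !filter_cat.
rewrite (@eq_in_filter _ _ pred0) ?filter_pred0; last first.
  by move=> B /h1 h /=; apply/negbTE; rewrite -leNgt ltW.
rewrite (@eq_in_filter _ _ pred0) ?filter_pred0; last first.
  by move=> B /h2 h /=; rewrite h ltxx.
by apply/all_filterP/allP.
Qed.

(** This is Q_+ in the notation of the opening comment. *)
Definition right_factor (R : realType) (a : R) (mu : seq (R * R * R)) := Qright a (right_of a mu).
(** This is Q_- in the notation of the opening comment. *)
Definition left_factor (R : realType) (a : R) (mu : seq (R * R * R)) := Qleft a (left_of a mu).

Lemma right_left_factor (R : realType) (a k : R) (mu : seq (R * R * R)) :
  admissible mu -> (pstate mu).2.[k] = 0 ->
  (right_factor a mu).[k] = (pstate mu).1.[k] * expR a * (left_factor a mu).[k].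
Proof.
move=> ad Wk; have Wk' := Wk; rewrite (split_at a ad) in Wk'.
by have := Qright_Qleft (@atoms_atP _ a mu) Wk'; rewrite -(split_at a ad).
Qed.

Lemma admissible_halves (R : realType) (a : R) (mu : seq (R * R * R)) :
  admissible mu -> admissible (left_of a mu) /\ admissible (right_of a mu).
Proof.
move=> ad; have ad' := ad; rewrite (split_at a ad) in ad'.
by have /admissible_cat[adl /admissible_cat[_ adr _] _] := ad'.
Qed.

Lemma right_factor0 (R : realType) (a : R) (mu : seq (R * R * R)) :
  admissible mu -> (right_factor a mu).[0] = 1.
Proof.
move=> /(admissible_halves a)[_ adr].
by have [P [[]]] := right_stieltjes adr (@right_ofP _ a mu).
Qed.

Lemma left_factor0 (R : realType) (a : R) (mu : seq (R * R * R)) :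
  admissible mu -> (left_factor a mu).[0] = 1.
Proof.
move=> /(admissible_halves a)[adl _].
by have [P [[]]] := left_stieltjes adl (@left_ofP _ a mu).
Qed.

(** The degrees of both factors and of the characteristic polynomial count the atoms to
    the right, those to the left, and all of them, with multiplicity 2 for those with
    v > 0. *)
Lemma size_factors (R : realType) (a : R) (mu : seq (R * R * R)) :
  admissible mu -> (size (right_factor a mu * left_factor a mu)%R <= size (pstate mu).2)%N.
Proof.
move=> ad; have [_ [_ _ ->]] := charpoly_stieltjes ad.
have [adl adr] := admissible_halves a ad.
have [_ [_ _ s1]] := right_stieltjes adr (@right_ofP _ a mu).
have [_ [_ _ s2]] := left_stieltjes adl (@left_ofP _ a mu).
apply: (leq_trans (size_polyMleq _ _)); rewrite s1 s2 addSn addnS succnK ltnS.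
rewrite [leqRHS](_ : _ = degree (left_of a mu)
    + (degree (atoms_at a mu) + degree (right_of a mu)))%N.
  by rewrite addnC leq_add2l leq_addl.
by rewrite {1}(split_at a ad) /degree !big_cat.
Qed.

Lemma eigenvalues_root (R : realType) (mu : seq (R * R * R)) (N : nat) (lam : 'I_N -> R) :
  admissible mu -> eigenvalues mu lam -> forall i, (pstate mu).2.[lam i] = 0.
Proof.
move=> ad [_ ev] i; have /(eigenvalueP _ ad) : Defs.eigenvalue mu (lam i)%:C by apply/ev; exists i.
by rewrite horner_map => /eqP; rewrite eq_complex /= eqxx andbT => /eqP.
Qed.

Lemma increasing_inj (R : realType) (N : nat) (lam : 'I_N -> R) :
  (forall i j : 'I_N, (i < j)%N -> lam i < lam j) -> injective lam.
Proof.
move=> inc i j e; apply/val_inj; case: (ltngtP i j) => // /inc; by rewrite e ltxx.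
Qed.

Lemma coupling_deriv_neq0 (R : realType) (mu : seq (R * R * R)) (k : R) :
  admissible mu -> (pstate mu).2.[k] = 0 -> (pstate mu).2^`().[k] != 0.
Proof.
move=> ad Wk; have := coupling_gt0 ad Wk; apply: contraTneq.
by rewrite /coupling => ->; rewrite mulr0 oppr0 ltxx.
Qed.

(** A further zero, possibly complex, of the characteristic polynomial would be an
    eigenvalue, hence one of the real numbers lam i, and this one would be a multiple
    zero; but the derivative does not vanish there, because the coupling constant is
    positive. *)
Lemma size_charpoly (R : realType) (mu : seq (R * R * R)) (N : nat) (lam : 'I_N -> R) :
  admissible mu -> eigenvalues mu lam -> size (pstate mu).2 = N.+1.
Proof.
move=> ad ev; have Wr := eigenvalues_root ad ev; have [inc ev2] := ev.
have inj := increasing_inj inc.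
set W := (pstate mu).2 in Wr *.
have W0 : W != 0.
  by apply: contra_eq_neq (charpoly0 ad) => e; rewrite -/W e horner0 eq_sym oner_neq0.
have /dvdpP[r WE] : \prod_(z <- [seq lam i | i <- enum 'I_N]) ('X - z%:P) %| W.
  apply: uniq_roots_dvdp; first by apply/allP => _ /mapP[i _ ->]; rewrite rootE Wr.
  by rewrite uniq_rootsE map_inj_uniq // enum_uniq.
have r0 : r != 0 by apply: contra_neq W0; rewrite WE => ->; rewrite mul0r.
have [sr|sr] := eqVneq (size r) 1%N.
  rewrite WE size_mul // ?sr; last by rewrite -size_poly_eq0 size_prod_XsubC.
  by rewrite size_prod_XsubC size_map size_enum_ord.
have /closed_rootP[z] : size (map_poly (real_complex R) r) != 1%N by rewrite size_map_poly.
rewrite rootE => /eqP rz.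
have /(eigenvalueP _ ad)/ev2[i zE] : (map_poly (real_complex R) W).[z] = 0.
  by rewrite WE rmorphM hornerM /= rz mul0r.
move: rz; rewrite zE horner_map => /eqP; rewrite eq_complex /= eqxx andbT => ri.
have /dvdpP[q qE] : 'X - (lam i)%:P %| \prod_(z <- [seq lam i | i <- enum 'I_N]) ('X - z%:P).
  rewrite dvdp_XsubCl root_prod_XsubC; apply/mapP; exists i => //; exact: mem_enum.
have := coupling_deriv_neq0 ad (Wr i); rewrite -/W WE qE derivM !derivM derivXsubC.
by rewrite !horner_arith (eqP ri) subrr !mulr0 mul0r addr0 eqxx.
Qed.

Lemma charpoly_unique (R : realType) (mu nu : seq (R * R * R)) (N : nat) (lam : 'I_N -> R) :
  admissible mu -> admissible nu -> eigenvalues mu lam -> eigenvalues nu lam ->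
  (pstate mu).2 = (pstate nu).2.
Proof.
move=> ad1 ad2 ev1 ev2.
have W1 := eigenvalues_root ad1 ev1; have W2 := eigenvalues_root ad2 ev2.
have x0 i := charroot_neq0 ad1 (W1 i).
have inj := increasing_inj ev1.1.
apply: (@poly_eq_nodes _ _ (fun i : 'I_N.+1 => oapp lam 0 (unlift ord0 i))).
- move=> i j; case: (unliftP ord0 i) => [i'|] ->; case: (unliftP ord0 j) => [j'|] ->;
    rewrite ?liftK ?unlift_none //=.
  + by move=> /inj ->.
  + by move=> h; have := x0 i'; rewrite h eqxx.
  + by move=> h; have := x0 j'; rewrite -h eqxx.
- by rewrite (size_charpoly ad1 ev1).
- by rewrite (size_charpoly ad2 ev2).
move=> i /=; case: (unliftP ord0 i) => [i'|] _ /=.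
  by rewrite W1 W2.
by rewrite !charpoly0.
Qed.

Lemma varphiE (R : realType) (mu : seq (R * R * R)) (k a : R) :
  admissible mu -> (pstate mu).2.[k] = 0 ->
  varphi mu k a = (expR (- a / 2) * (right_factor a mu).[k] / Num.sqrt (coupling mu k))%:C.
Proof.
move=> ad Wk; rewrite /varphi phi_plus_real // gamma2_coupling //.
by rewrite [RHS]rmorphM fmorphV.
Qed.

Lemma normc_varphi (R : realType) (mu : seq (R * R * R)) (k a : R) :
  admissible mu -> (pstate mu).2.[k] = 0 ->
  normc (varphi mu k a) ^+ 2 * (expR a * coupling mu k) = (right_factor a mu).[k] ^+ 2.
Proof.
move=> ad Wk; rewrite varphiE // normc_real real_normK ?num_real //.
have cg := coupling_gt0 ad Wk.
rewrite expr_div_n sqr_sqrtr ?ltW // exprMn.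
have [-> _ e3] := expR_half a.
have -> : expR (- a / 2) ^+ 2 * (right_factor a mu).[k] ^+ 2 / coupling mu k
    * (expR (a / 2) ^+ 2 * coupling mu k) =
    (expR (a / 2) * expR (- a / 2)) ^+ 2 * (right_factor a mu).[k] ^+ 2.
  by field; rewrite gt_eqF.
by rewrite e3 expr1n mul1r.
Qed.

Lemma varphi_eq0 (R : realType) (mu : seq (R * R * R)) (k a : R) :
  admissible mu -> (pstate mu).2.[k] = 0 ->
  (varphi mu k a == 0) = ((right_factor a mu).[k] == 0).
Proof.
move=> ad Wk; rewrite varphiE // eq_complex /= eqxx andbT !mulf_eq0 invr_eq0.
by rewrite sqrtr_eq0 leNgt coupling_gt0 // gt_eqF ?expR_gt0 //= orbF.
Qed.

(** The residue at k of the Green's function on the diagonal at a. *)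
Lemma factors_residue (R : realType) (mu : seq (R * R * R)) (k a : R) :
  admissible mu -> (pstate mu).2.[k] = 0 ->
  (right_factor a mu * left_factor a mu).[k]
  = - (k * normc (varphi mu k a) ^+ 2 * (pstate mu).2^`().[k]).
Proof.
move=> ad Wk; have h1 := normc_varphi a ad Wk; have h2 := right_left_factor a ad Wk.
have cg := coupling_gt0 ad Wk.
have A0 : (pstate mu).1.[k] * expR a != 0.
  apply: mulf_neq0; last by rewrite gt_eqF ?expR_gt0.
  apply: contraTneq cg; rewrite /coupling => ->.
  by rewrite mulr0 mul0r oppr0 ltxx.
apply: (mulIf A0); rewrite hornerM.
have -> : (right_factor a mu).[k] * (left_factor a mu).[k] * ((pstate mu).1.[k] * expR a)
    = (right_factor a mu).[k] ^+ 2.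
  by rewrite expr2 {3}h2; ring.
by rewrite -h1 /coupling; ring.
Qed.

(** The uniqueness half of the theorem: by [factor_unique] both pairs have the same Q_+. *)
Lemma coupling_unique (R : realType) (mu nu : seq (R * R * R)) (a : R) (N : nat)
    (lam : 'I_N -> R) (p : 'I_N -> R[i]) :
  pairs_with a lam p mu -> pairs_with a lam p nu -> alpha p = 0 -> beta lam p = 0 ->
  forall i, p i != 0 -> coupling mu (lam i) = coupling nu (lam i).
Proof.
case: N lam p => [|n] lam p; first by move=> _ _ _ _ [].
move=> [/is_pairE[_ ad1] [ev1 p1]] [/is_pairE[_ ad2] [ev2 p2]] al be.
have W1 := eigenvalues_root ad1 ev1; have W2 := eigenvalues_root ad2 ev2.
have WE := charpoly_unique ad1 ad2 ev1 ev2.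
have QE : right_factor a mu = right_factor a nu.
  apply: (@factor_unique _ n lam (fun i => normc (p i) ^+ 2) (pstate mu).2
      (right_factor a mu) (left_factor a mu) (right_factor a nu) (left_factor a nu)) => //.
  - exact: increasing_inj ev1.1.
  - by move=> i; exact: charroot_neq0 ad1 (W1 i).
  - exact: size_charpoly ad1 ev1.
  - exact: charpoly0.
  - by move=> i; exact: coupling_deriv_neq0 ad1 (W1 i).
  - by move=> i; exact: sqr_ge0.
  - by move/eqP: al; rewrite /alpha subr_eq0 => /eqP <-.
  - by move/eqP: be; rewrite /beta oppr_eq0 => /eqP.
  - by rewrite -(size_charpoly ad1 ev1); exact: size_factors.
  - by rewrite -(size_charpoly ad2 ev2); exact: size_factors.
  - exact: right_factor0.
  - exact: left_factor0.
  - exact: right_factor0.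
  - exact: left_factor0.
  - by move=> i; rewrite p1; exact: factors_residue.
  - by move=> i; rewrite p2 WE; exact: factors_residue.
  - move=> i nz; have pn : p i != 0.
      by apply: contra_neq nz => ->; rewrite normc0 expr0n.
    have e1 := p1 i; have e2 := p2 i; rewrite !varphiE // in e1 e2.
    have : (expR (- a / 2) * (right_factor a mu).[lam i] / Num.sqrt (coupling mu (lam i)))
         = (expR (- a / 2) * (right_factor a nu).[lam i] / Num.sqrt (coupling nu (lam i))).
      by have /eqP := etrans (esym e1) e2; rewrite eq_complex => /andP[/eqP].
    have s1 : 0 < Num.sqrt (coupling mu (lam i)) by rewrite sqrtr_gt0 coupling_gt0.
    have s2 : 0 < Num.sqrt (coupling nu (lam i)) by rewrite sqrtr_gt0 coupling_gt0.
    have E0 := expR_gt0 (- a / 2).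
    move=> e; have qn : (right_factor a nu).[lam i] != 0.
      by apply: contra_neq pn; rewrite e2 => ->; rewrite mulr0 mul0r.
    have -> : (right_factor a mu).[lam i]
        = (Num.sqrt (coupling mu (lam i)) / Num.sqrt (coupling nu (lam i)))
        * (right_factor a nu).[lam i].
      apply: (mulfI (lt0r_neq0 E0)); rewrite -[LHS](divfK (lt0r_neq0 s1)) e; field.
      by rewrite gt_eqF.
    rewrite -[X in 0 < X]mulrA; apply: mulr_gt0; first exact: divr_gt0.
    by rewrite -expr2 exprn_even_gt0.
  - move=> i /eqP; rewrite sqrf_eq0 => /eqP/eq0_normc pz.
    have /eqP := pz; rewrite {1}p1 varphi_eq0 // => /eqP ->.
    by have /eqP := pz; rewrite {1}p2 varphi_eq0 // => /eqP ->.
move=> i pi0.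
have h1 := normc_varphi a ad1 (W1 i); have h2 := normc_varphi a ad2 (W2 i).
rewrite -p1 in h1; rewrite -p2 -QE -h1 in h2.
have n0 : normc (p i) ^+ 2 != 0.
  by rewrite sqrf_eq0; apply: contra_neq pi0 => /eq0_normc.
by move: h2 => /(mulfI n0)/(mulfI (lt0r_neq0 (expR_gt0 a))) ->.
Qed.

(** At an eigenvalue whose eigenfunction vanishes at a both Q_+ and Q_- vanish, so that
    [redistribute] applies. *)
Lemma change_one (R : realType) (mu : seq (R * R * R)) (a : R) (N : nat)
    (lam : 'I_N -> R) (p : 'I_N -> R[i]) (i : 'I_N) (g : R) :
  pairs_with a lam p mu -> p i = 0 -> 0 < g ->
  exists nu, [/\ pairs_with a lam p nu, coupling nu (lam i) = g &
    forall j, j != i -> coupling nu (lam j) = coupling mu (lam j)].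
Proof.
move=> [/is_pairE[_ ad] [ev pE]] pi0 g0.
have W := eigenvalues_root ad ev.
have Qpi : (right_factor a mu).[lam i] = 0.
  by apply/eqP; rewrite -(varphi_eq0 a ad) // -pE pi0.
have Qmi : (left_factor a mu).[lam i] = 0.
  have := right_left_factor a ad (W i); rewrite Qpi => /esym/eqP.
  rewrite mulf_eq0 => /orP[|/eqP //].
  rewrite mulf_eq0 (gt_eqF (expR_gt0 a)) orbF => /eqP A0.
  by have := coupling_gt0 ad (W i); rewrite /coupling A0 mulr0 mul0r oppr0 ltxx.
have ad' := ad; rewrite (split_at a ad) in ad'.
have [t1 [t2 [adt [l1 l2] [Q1 Q2] WE [ci cj]]]] := redistribute ad' (@left_ofP _ a mu)
  (@atoms_atP _ a mu) (@right_ofP _ a mu) Qmi Qpi g0.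
rewrite -(split_at a ad) in WE cj.
set nu := t1 ++ _ ++ t2 in adt WE ci cj.
have QpE : right_factor a nu = right_factor a mu.
  by rewrite {1}/right_factor right_of_split //; exact: atoms_atP.
have ijn j : j != i -> lam j != lam i by rewrite (inj_eq (increasing_inj ev.1)).
have cE j : j != i -> coupling nu (lam j) = coupling mu (lam j).
  by move=> ji; rewrite cj // ijn.
exists nu; split=> //; split.
  apply/is_pairE; split=> //.
  have := size_charpoly ad ev; rewrite -WE; case: (nu) => //= .
  rewrite size_poly1 => -[e]; by have := leq_ltn_trans (leq0n i) (ltn_ord i); rewrite -{1}e.
split.
  split; first exact: ev.1.
  by move=> z; rewrite (eigenvalueP _ adt) WE -(eigenvalueP _ ad); exact: ev.2.
move=> j; have Wj : (pstate nu).2.[lam j] = 0 by rewrite WE.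
have [->|ji] := eqVneq j i.
  by apply/esym/eqP; rewrite pi0 varphi_eq0 ?WE // QpE Qpi.
by rewrite pE !varphiE // QpE cE.
Qed.

(** The free coupling constants are adjusted one after the other. *)
Lemma prescribe_couplings (R : realType) (mu : seq (R * R * R)) (a : R) (N : nat)
    (lam : 'I_N -> R) (p : 'I_N -> R[i]) (g : 'I_N -> R) :
  pairs_with a lam p mu -> (forall i, p i = 0 -> 0 < g i) ->
  (forall i, p i != 0 -> g i = coupling mu (lam i)) ->
  exists2 nu, pairs_with a lam p nu & forall i, coupling nu (lam i) = g i.
Proof.
move=> hmu g0 gE.
have [nu hnu [h1 h2]] : exists2 nu, pairs_with a lam p nu &
    {in [seq i <- enum 'I_N | p i == 0], forall i, coupling nu (lam i) = g i} /\
    forall i, i \notin [seq i <- enum 'I_N | p i == 0] ->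
      coupling nu (lam i) = coupling mu (lam i).
  have : {in [seq i <- enum 'I_N | p i == 0], forall i, p i = 0}.
    by move=> i; rewrite mem_filter => /andP[/eqP].
  elim: [seq i <- enum 'I_N | p i == 0] => [|i s IH] ps; first by exists mu.
  have [|nu hnu [h1 h2]] := IH; first by move=> j sj; apply: ps; rewrite inE sj orbT.
  have pi0 : p i = 0 by apply: ps; rewrite mem_head.
  have [nu' [hnu' ci cj]] := change_one hnu pi0 (g0 i pi0).
  exists nu' => //; split=> j; rewrite inE.
    have [-> //|ji] := eqVneq j i; by move=> /= /h1 <-; exact: cj.
  by rewrite negb_or => /andP[ji sj]; rewrite cj // h2.
exists nu => // i; have [pi0|pi0] := eqVneq (p i) 0.
  by apply: h1; rewrite mem_filter pi0 eqxx mem_enum.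
by rewrite h2 ?gE // mem_filter (negPf pi0).
Qed.

Lemma increasing_unique (R : realType) (N : nat) (lam lam' : 'I_N -> R) :
  (forall i j : 'I_N, (i < j)%N -> lam i < lam j) ->
  (forall i j : 'I_N, (i < j)%N -> lam' i < lam' j) ->
  (forall x, (exists i, x = lam i) <-> (exists i, x = lam' i)) -> lam = lam'.
Proof.
move=> inc inc' same.
have st (l : 'I_N -> R) : (forall i j : 'I_N, (i < j)%N -> l i < l j) ->
    sorted <%R [seq l i | i <- enum 'I_N].
  move=> incl; rewrite sorted_map; apply: (@sub_sorted _ (relpre val ltn)).
    by move=> i j /incl.
  by rewrite -sorted_map val_enum_ord iota_ltn_sorted.
have : [seq lam i | i <- enum 'I_N] = [seq lam' i | i <- enum 'I_N].
  apply: (irr_sorted_eq lt_trans ltxx (st _ inc) (st _ inc')) => x.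
  apply/mapP/mapP => -[i _ ->].
    have [|j ->] := (same (lam i)).1; first by exists i.
    by exists j => //; exact: mem_enum.
  have [|j ->] := (same (lam' i)).2; first by exists i.
  by exists j => //; exact: mem_enum.
by move=> /eq_in_map h; apply/funext => i; apply: h; exact: mem_enum.
Qed.

Lemma spectral_setP (R : realType) (mu : seq (R * R * R)) (a : R) (N : nat)
    (lam : 'I_N -> R) (p : 'I_N -> R[i]) (s : 'rV[R]_(N + N)) :
  pairs_with a lam p mu -> alpha p = 0 -> beta lam p = 0 ->
  spectral_set a lam p s <->
  exists g : 'I_N -> R, [/\ forall i, p i = 0 -> 0 < g i,
    forall i, p i != 0 -> g i = coupling mu (lam i) &
    s = row_mx (\row_i lam i) (\row_i g i)].
Proof.
move=> hmu al be; split.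
  move=> [nu hnu [lam' [ev' ->]]].
  have [/is_pairE[_ ad] [ev pE]] := hnu.
  have W := eigenvalues_root ad ev.
  have lamE : lam' = lam.
    apply: increasing_unique; [exact: ev'.1|exact: ev.1|] => x.
    have e1 := ev'.2 x%:C; have e2 := ev.2 x%:C.
    split=> -[i xE].
      by have [j /eqP] := e2.1 (e1.2 (ex_intro _ i (congr1 _ xE)));
        rewrite eq_complex => /andP[/eqP /= h _]; exists j.
    by have [j /eqP] := e1.1 (e2.2 (ex_intro _ i (congr1 _ xE)));
      rewrite eq_complex => /andP[/eqP /= h _]; exists j.
  exists (fun i => coupling nu (lam i)); split.
  - by move=> i _; exact: coupling_gt0 ad (W i).
  - by move=> i; exact: (coupling_unique hnu hmu al be).
  rewrite lamE; congr row_mx; apply/rowP => i; rewrite !mxE.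
  by rewrite gamma2_coupling.
move=> [g [g0 gE ->]]; have [nu hnu cE] := prescribe_couplings hmu g0 gE.
have [/is_pairE[_ ad] [ev _]] := hnu.
exists nu => //; exists lam; split=> //.
congr row_mx; apply/rowP => i; rewrite !mxE gamma2_coupling ?cE //.
exact: eigenvalues_root.
Qed.

(** * The topology of the spectral set *)

Lemma continuous_rV (R : realType) (T : topologicalType) (n : nat) (f : T -> 'rV[R]_n) :
  (forall j, continuous (fun x => f x 0 j)) -> continuous f.
Proof.
move=> cf x A [B nB sBA].
have : \forall y \near x, forall i j, B i j (f y i j).
  apply: filter_forall => i; apply: filter_forall => j.
  by rewrite (ord1 i); exact: (cf j x _ (nB 0 j)).
by apply: filterS => y hy; apply: sBA => i j; exact: hy.
Qed.

Definition orthant (R : realType) (k : nat) : set 'rV[R]_k :=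
  [set v | forall j, 0 < v 0 j].

Lemma orthant_open (R : realType) (k : nat) : open (@orthant R k).
Proof.
rewrite openE => v v0; have : \forall w \near v, forall j, 0 < (w : 'rV[R]_k) 0 j.
  apply: (@filter_forall _ _ (fun j (w : 'rV[R]_k) => 0 < w 0 j) (nbhs v)) => j.
  exact: (@coord_continuous R 1 k 0 j v [set x | 0 < x] (lt_nbhsr (v0 j))).
by [].
Qed.

(** The values of v at the indices in Z, completed by those of g0. *)
Definition insert_free (R : realType) (N : nat) (Z : {set 'I_N}) (g0 : 'I_N -> R)
    (v : 'rV[R]_#|Z|) (i : 'I_N) : R :=
  if [pick j | enum_val j == i] is Some j then v 0 j else g0 i.

Definition spectral_chart (R : realType) (N : nat) (Z : {set 'I_N}) (lam g0 : 'I_N -> R)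
    (v : 'rV[R]_#|Z|) : 'rV[R]_(N + N) :=
  row_mx (\row_i lam i) (\row_i insert_free g0 v i).

Definition free_part (R : realType) (N : nat) (Z : {set 'I_N}) (s : 'rV[R]_(N + N)) :
  'rV[R]_#|Z| := \row_j s 0 (rshift N (enum_val j)).

Lemma insert_free_in (R : realType) (N : nat) (Z : {set 'I_N}) (g0 : 'I_N -> R)
    (v : 'rV[R]_#|Z|) (j : 'I_#|Z|) : insert_free g0 v (enum_val j) = v 0 j.
Proof.
rewrite /insert_free; case: pickP => [j' /eqP/enum_val_inj -> //|/(_ j)].
by rewrite eqxx.
Qed.

Lemma insert_free_out (R : realType) (N : nat) (Z : {set 'I_N}) (g0 : 'I_N -> R)
    (v : 'rV[R]_#|Z|) (i : 'I_N) : i \notin Z -> insert_free g0 v i = g0 i.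
Proof.
rewrite /insert_free; case: pickP => [j /eqP <-|//].
by rewrite enum_valP.
Qed.

Lemma spectral_chartK (R : realType) (N : nat) (Z : {set 'I_N}) (lam g0 : 'I_N -> R)
    (v : 'rV[R]_#|Z|) : free_part Z (spectral_chart lam g0 v) = v.
Proof. by apply/rowP => j; rewrite mxE row_mxEr mxE insert_free_in. Qed.

Lemma spectral_chart_cont (R : realType) (N : nat) (Z : {set 'I_N}) (lam g0 : 'I_N -> R) :
  continuous (@spectral_chart R N Z lam g0).
Proof.
apply: continuous_rV => j; rewrite /spectral_chart.
case: (split_ordP j) => i ->.
  under eq_fun do rewrite row_mxEl mxE.
  exact: cst_continuous.
under eq_fun do rewrite row_mxEr mxE.
rewrite /insert_free; case: pickP => [j' _|_]; last exact: cst_continuous.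
exact: coord_continuous.
Qed.

Lemma free_part_cont (R : realType) (N : nat) (Z : {set 'I_N}) :
  continuous (@free_part R N Z).
Proof.
apply: continuous_rV => j; rewrite /free_part.
under eq_fun do rewrite mxE.
exact: coord_continuous.
Qed.

(** The orthant is star-shaped with respect to the vector of ones. *)
Lemma orthant_connected (R : realType) (k : nat) : connected (@orthant R k).
Proof.
pose h (v : 'rV[R]_k) (t : R) : 'rV[R]_k := (1 - t) *: const_mx 1 + t *: v.
have -> : @orthant R k = \bigcup_(v in @orthant R k) (h v @` `[0, 1]).
  apply/seteqP; split=> [v v0|_ [v v0 [t t01 <-]] j].
    exists v => //; exists 1; first by rewrite /= in_itv /= ler01 lexx.
    by rewrite /h subrr scale0r add0r scale1r.
  move: t01; rewrite /= in_itv /= => /andP[t0 t1]; rewrite !mxE mulr1.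
  have vj := v0 j; have [->|tn] := eqVneq t 0; first by rewrite subr0 mul0r addr0.
  by rewrite ltr_wpDl ?subr_ge0 // mulr_gt0 // lt_def tn.
apply: bigcup_connected.
  exists (const_mx 1) => v v0; exists 0; first by rewrite /= in_itv /= ler01 lexx.
  by rewrite /h subr0 scale0r addr0 scale1r.
move=> v v0; apply: connected_continuous_connected; first exact: segment_connected.
apply: continuous_subspaceT; apply: continuous_rV => j; rewrite /h.
under eq_fun do rewrite !mxE.
move=> t; apply: cvgD; apply: cvgM; try exact: cvg_cst.
  by apply: cvgB; [exact: cvg_cst|exact: cvg_id].
exact: cvg_id.
Qed.

(** The parametrisation of the spectral set by the free coupling constants, those of the
    eigenfunctions which vanish at a. *)
Lemma spectral_set_chart (R : realType) (mu : seq (R * R * R)) (a : R) (N : nat)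
    (lam : 'I_N -> R) (p : 'I_N -> R[i]) :
  pairs_with a lam p mu -> alpha p = 0 -> beta lam p = 0 ->
  let Z := [set i | p i == 0]%SET in
  spectral_set a lam p =
  spectral_chart lam (fun i => coupling mu (lam i)) @` @orthant R #|Z|.
Proof.
move=> hmu al be Z; apply/seteqP; split=> s.
  move=> /(spectral_setP _ hmu al be)[g [g0 gE ->]].
  exists (\row_(j < #|Z|) g (enum_val j)).
    move=> j; rewrite mxE; apply: g0; have := enum_valP j.
    by rewrite inE => /eqP.
  congr row_mx; apply/rowP => i; rewrite !mxE.
  have [iZ|iZ] := boolP (i \in Z).
    by rewrite -(enum_rankK_in iZ iZ) insert_free_in mxE.
  by rewrite insert_free_out // gE //; move: iZ; rewrite inE.
move=> [v v0 <-]; apply/(spectral_setP _ hmu al be).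
exists (insert_free (fun i => coupling mu (lam i)) v); split=> // i.
  move=> /eqP pi0; have iZ : i \in Z by rewrite inE.
  by rewrite -(enum_rankK_in iZ iZ) insert_free_in.
by move=> pi0; rewrite insert_free_out // inE.
Qed.

Theorem theorem4p3 (R : realType) (a : R) (N : nat)
    (lam : 'I_N -> R) (p : 'I_N -> R[i]) (k : nat)
    (hdata : exists mu : seq (R * R * R),
       is_pair mu /\ interior_spectral_data mu a lam p)
    (halpha : alpha p = 0) (hbeta : beta lam p = 0)
    (hk : (1 <= k)%N) (hzero : #|[set i : 'I_N | p i == 0]%SET| = k) :
  [/\ infinite_set (pairs_with a lam p),
      connected (spectral_set a lam p) &
      manifold k (spectral_set a lam p)].
Proof.
have [mu hmu] := hdata; subst k.
have /= SE := spectral_set_chart hmu halpha hbeta.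
set Z := [set i | p i == 0]%SET in hk SE *.
pose G := @spectral_chart R N Z lam (fun i => coupling mu (lam i)).
rewrite -/G in SE.
split.
- move=> fin.
  pose j0 : 'I_#|Z| := Ordinal hk.
  have : finite_set ((fun nu => coupling nu (lam (enum_val j0))) @` pairs_with a lam p).
    exact: finite_image.
  (* Every positive integer is a value of this coupling constant. *)
  pose q (n : nat) : R := n.+1%:R.
  have qinj : injective q by move=> m n /eqP; rewrite eqr_nat => /eqP [].
  move=> fin'; apply: infinite_nat.
  rewrite -(_ : q @^-1` ((fun nu => coupling nu (lam (enum_val j0))) @` pairs_with a lam p)
    = [set: nat]); first by apply: finite_preimage fin' => m n _ _; exact: qinj.
  apply/seteqP; split=> // n _ /=.
  have pj0 : p (enum_val j0) = 0 by have := enum_valP j0; rewrite inE => /eqP.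
  have [|nu [h1 h2 _]] := @change_one _ _ _ _ _ _ (enum_val j0) (q n) hmu pj0; first exact: ltr0Sn.
  by exists nu.
- rewrite SE; apply: connected_continuous_connected; first exact: orthant_connected.
  apply: continuous_subspaceT; exact: spectral_chart_cont.
move=> s _; exists setT, (@orthant R #|Z|); split=> //.
- exact: openT.
- exact: orthant_open.
exists (@free_part R N Z), G; split.
- rewrite setIT SE => _ [v v0 <-]; rewrite spectral_chartK; split=> //.
- by move=> v v0; rewrite setIT SE spectral_chartK; split=> //; exists v.
- apply: continuous_subspaceT; exact: free_part_cont.
- apply: continuous_subspaceT; exact: spectral_chart_cont.
Qed.
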